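(* The connective constant of the hexagonal lattice $\mathbb H$ satisfies $\kappa(\mathbb H)=\sqrt{2+\sqrt 2}$; that is, if $\sigma_n$ is the number of self-avoiding walks of length $n$ on $\mathbb H$ starting at a fixed vertex, then $\lim_{n\to\infty}\sigma_n^{1/n}=\sqrt{2+\sqrt2}$.
   Context: The hexagonal (honeycomb) lattice $\mathbb H$ is the planar lattice in which every vertex has degree 3 and every face is a regular hexagon (the planar dual of the triangular lattice). A self-avoiding walk is a lattice path visiting no vertex more than once. *)

(* Defs.v *)
From Stdlib Require Import Reals ZArith List.
Import ListNotations.
Open Scope Z_scope.

(* The hexagonal (honeycomb) lattice H, realised as the "brick-wall"
   embedding on Z x Z: every vertex (x,y) is adjacent to (x+1,y), (x-1,y),
   and to (x,y+1) if x+y is even, resp. (x,y-1) if x+y is odd.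
   This graph is 3-regular and isomorphic to the honeycomb lattice. *)
Definition vertex := (Z * Z)%type.

Definition hex_adj (p q : vertex) : Prop :=
  let (x, y) := p in
  let (x', y') := q in
  (y' = y /\ (x' = x + 1 \/ x' = x - 1)) \/
  (x' = x /\ ((Z.even (x + y) = true /\ y' = y + 1) \/
              (Z.even (x + y) = false /\ y' = y - 1))).

Definition origin : vertex := (0, 0).

Definition is_saw (n : nat) (w : list vertex) : Prop :=
  length w = S n /\
  nth 0 w origin = origin /\
  (forall i : nat, (i < n)%nat -> hex_adj (nth i w origin) (nth (S i) w origin)) /\
  NoDup w.

Definition counts_saws (sigma : nat -> nat) : Prop :=
  forall n : nat, exists L : list (list vertex),
    NoDup L /\ length L = sigma n /\ (forall w, In w L <-> is_saw n w).

(* Main.v *)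
(* The proof is that of Duminil-Copin and Smirnov, with x_c = 1 / (2 cos (pi/8)).
   Give a walk of length n with t left turns more than right turns the weight
   x_c^n cos (t pi/8), the real part of their parafermionic observable. At x_c the
   weight of a walk is the sum of the weights of its two one-step continuations,
   and continuations that close a loop cancel in pairs (run through the loop
   backwards). Hence in any domain of the upper half-plane the walks leaving the
   domain have total weight 1, up to the walks of a given length still inside.
   - In a finite rectangle all exit weights are nonnegative, so bridges have total
     weight at most 1 at x_c. Below x_c they decay geometrically in their height, and
     the Hammersley-Welsh decomposition into bridges bounds sigma_n x^n.
   - If sigma_m x_c^m < 1 for some m, then by submultiplicativity the series of
     sigma_n x_c^n converges, and the identity in infinite strips forces bridges of
     every height to have weight bounded below, contradicting convergence.
   That the turning number of a walk leaving the domain depends only on its exit, and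
   that of a loop only on its orientation, is a discrete form of Hopf's Umlaufsatz:
   the rotation of the successive steps equals that of the secants through the last
   vertex.

   Walks are lists in reverse order: the head is the current end point. *)
Require Import Defs.
From Stdlib Require Import Reals ZArith List Lia Lra Permutation Bool.
Import ListNotations.
Open Scope Z_scope.

(** The weight comes from the observable of spin 5/8: a walk of winding W carries exp(-5iW/8), and
    the direction of its last step contributes exp(iW). The product is exp(3iW/8), and a single turn
    W = pi/3 gives the angle pi/8. Running through a loop backwards changes the turning by 8 units,
    hence the phase by pi, which makes closing walks cancel; with b = pi/8, the formula cos(a + b) +
    cos(a - b) = 2 cos a cos b then dictates xc. The angle is also small enough for positivity:
    exits of a rectangle have turning between -3 and 3, and 3 pi/8 < pi/2. Directions are integers
    modulo 6 and their lift to the integers is recorded by crossings of one ray, so that invariance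
    under deformation reduces to a finite check on pairs of unit steps. The other obstacle is
    parity. A vertex has a single vertical edge, going up at even and down at odd vertices, so that
    bridges end at even vertices only. Every cut at a highest or lowest vertex has to deal with the
    parity of that vertex. *)

Definition vsub (p q : vertex) : vertex := (fst p - fst q, snd p - snd q).

(** * Turning of walks in the upper half-plane *)

Definition xpos (u : vertex) : Z := if 0 <? fst u then 1 else 0.

(* Signed number of times the motion from [u] to [u'] crosses counterclockwise the ray
   going down from the origin, pushed slightly to the right. *)
Definition cross (u u' : vertex) : Z :=
  if (snd u <? 0) && (snd u' <? 0) then xpos u' - xpos u else 0.

Lemma xpos_cases (u : vertex) :
  (xpos u = 1 /\ 0 < fst u) \/ (xpos u = 0 /\ fst u <= 0).
Proof. unfold xpos. destruct (Z.ltb_spec 0 (fst u)); lia. Qed.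

Lemma cross_cases (u u' : vertex) :
  (snd u < 0 /\ snd u' < 0 /\ cross u u' = xpos u' - xpos u) \/
  ((0 <= snd u \/ 0 <= snd u') /\ cross u u' = 0).
Proof.
  unfold cross. destruct (Z.ltb_spec (snd u) 0), (Z.ltb_spec (snd u') 0); simpl; lia.
Qed.

Definition unit_step (p q : vertex) : Prop :=
  (snd q = snd p /\ (fst q = fst p + 1 \/ fst q = fst p - 1)) \/
  (fst q = fst p /\ (snd q = snd p + 1 \/ snd q = snd p - 1)).

Lemma hex_adj_unit_step (p q : vertex) : hex_adj p q -> unit_step p q.
Proof. destruct p, q; unfold hex_adj, unit_step; simpl; intuition. Qed.

Lemma hex_adj_sym (p q : vertex) : hex_adj p q -> hex_adj q p.
Proof.
  destruct p as [x y], q as [x' y']; unfold hex_adj.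
  intros [[-> [-> | ->]] | [-> [[H ->] | [H ->]]]].
  - left; lia.
  - left; lia.
  - right; split; [reflexivity|right]. split; [|lia].
    replace (x + (y + 1)) with (Z.succ (x + y)) by lia.
    rewrite Z.even_succ, <- Z.negb_even, H; reflexivity.
  - right; split; [reflexivity|left]. split; [|lia].
    replace (x + (y - 1)) with (Z.pred (x + y)) by lia.
    rewrite Z.even_pred, <- Z.negb_even, H; reflexivity.
Qed.

Lemma vertex_neq (p q : vertex) : p <> q -> fst p <> fst q \/ snd p <> snd q.
Proof.
  intro H. destruct (Z.eq_dec (fst p) (fst q)) as [E|]; auto. right. intro E'.
  apply H. destruct p, q; simpl in *; congruence.
Qed.

(* The only unit square around the tip of the ray has the origin as a corner. *)
Lemma cross_quad (a b z z' : vertex) :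
  unit_step b a -> unit_step z z' -> z <> a -> z <> b -> z' <> a -> z' <> b ->
  cross (vsub z b) (vsub z a) + cross (vsub z a) (vsub z' a) =
  cross (vsub z b) (vsub z' b) + cross (vsub z' b) (vsub z' a).
Proof.
  intros H1 H2 N1%vertex_neq N2%vertex_neq N3%vertex_neq N4%vertex_neq.
  destruct a as [ax ay], b as [bx b_y], z as [zx zy], z' as [wx wy].
  unfold unit_step, vsub in *; cbn [fst snd] in *.
  unfold cross, xpos; cbn [fst snd].
  destruct H1 as [[-> [-> | ->]] | [-> [-> | ->]]], H2 as [[-> [-> | ->]] | [-> [-> | ->]]];
  repeat match goal with
  | |- context [?p <? ?q] => destruct (Z.ltb_spec p q); try (exfalso; lia)
  end; cbn [andb]; lia.
Qed.

Fixpoint chain (l : list vertex) : Prop :=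
  match l with
  | a :: ((b :: _) as t) => hex_adj b a /\ chain t
  | _ => True
  end.

Lemma last_cons_default (A : Type) (l : list A) a d : last (a :: l) d = last l a.
Proof.
  revert a d. induction l as [|b l IH]; intros a d; [reflexivity|].
  change (last (a :: b :: l) d) with (last (b :: l) d). rewrite IH. symmetry. apply IH.
Qed.

Lemma last_in (A : Type) (l : list A) a : In (last l a) (a :: l).
Proof.
  revert a. induction l as [|b l IH]; intro a; [left; auto|].
  rewrite last_cons_default. right. apply IH.
Qed.

(* Total of [cross] along the vectors from the vertices of the walk to [z]. *)
Fixpoint cutsum (z : vertex) (l : list vertex) : Z :=
  match l with
  | a :: ((b :: _) as t) => cross (vsub z b) (vsub z a) + cutsum z t
  | _ => 0
  end.

Lemma cutsum_cons2 z a b l :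
  cutsum z (a :: b :: l) = cross (vsub z b) (vsub z a) + cutsum z (b :: l).
Proof. reflexivity. Qed.

Lemma cutsum_app z l a m :
  cutsum z (l ++ a :: m) = cutsum z (l ++ [a]) + cutsum z (a :: m).
Proof.
  induction l as [|c [|d l] IH]; simpl app in *.
  - simpl; lia.
  - rewrite !cutsum_cons2. simpl (cutsum z [a]). lia.
  - rewrite !cutsum_cons2, IH. lia.
Qed.

Lemma chain_app l a m : chain (l ++ a :: m) <-> chain (l ++ [a]) /\ chain (a :: m).
Proof.
  induction l as [|c [|d l] IH]; simpl app in *.
  - simpl; tauto.
  - change (chain (c :: a :: m)) with (hex_adj a c /\ chain (a :: m)).
    change (chain [c; a]) with (hex_adj a c /\ True). tauto.
  - change (chain (c :: d :: l ++ a :: m)) with (hex_adj d c /\ chain (d :: l ++ a :: m)).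
    change (chain (c :: d :: l ++ [a])) with (hex_adj d c /\ chain (d :: l ++ [a])). tauto.
Qed.

(** A discrete homotopy: each edge of the walk spans with the step from [z] to [z'] a quadrilateral
    around which the crossings balance ([cross_quad]), and the inner sides telescope along the
    walk. *)
Lemma cutsum_move (z z' a : vertex) (l : list vertex) :
  unit_step z z' -> chain (a :: l) -> ~ In z (a :: l) -> ~ In z' (a :: l) ->
  cutsum z' (a :: l) + cross (vsub z (last l a)) (vsub z' (last l a)) =
  cutsum z (a :: l) + cross (vsub z a) (vsub z' a).
Proof.
  intros Hz. revert a. induction l as [|b l IH]; intros a C N N'.
  - simpl; lia.
  - destruct C as [Hab C].
    rewrite last_cons_default, !cutsum_cons2.
    specialize (IH b C (fun h => N (or_intror h)) (fun h => N' (or_intror h))).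
    pose proof (cross_quad a b z z' (hex_adj_unit_step _ _ Hab) Hz) as Q.
    simpl in N, N'.
    rewrite <- Z.add_assoc, IH.
    enough (cross (vsub z b) (vsub z a) + cross (vsub z a) (vsub z' a) =
      cross (vsub z b) (vsub z' b) + cross (vsub z' b) (vsub z' a)) by lia.
    apply Q; intro; subst; tauto.
Qed.

(** All secants point downwards, where [cross] is a difference of values of [xpos], so the sum
    telescopes. *)
Lemma cutsum_below (z a : vertex) (l : list vertex) :
  (forall b, In b (a :: l) -> snd z < snd b) ->
  cutsum z (a :: l) = xpos (vsub z a) - xpos (vsub z (last l a)).
Proof.
  revert a. induction l as [|b l IH]; intros a H.
  - simpl; lia.
  - rewrite last_cons_default, cutsum_cons2, IH by (intros; apply H; right; auto).
    assert (snd z < snd a) by (apply H; left; auto).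
    assert (snd z < snd b) by (apply H; right; left; auto).
    destruct (cross_cases (vsub z b) (vsub z a)) as [C|C];
      unfold vsub in C; simpl in C; unfold vsub; lia.
Qed.

(* Direction of an edge of the regular honeycomb, in units of 60 degrees counted
   counterclockwise from the upward vertical: an edge going right in the brick wall
   points 60 or 120 degrees clockwise from it, according to the parity of its origin. *)
Definition edir (u w : vertex) : Z :=
  if snd u <? snd w then 0
  else if snd w <? snd u then 3
  else if fst u <? fst w then (if Z.even (fst u + snd u) then -2 else -1)
  else (if Z.even (fst u + snd u) then 2 else 1).

(** The crossings while the step from [u] to [v] is deformed into the step from [v] to [w]: first
    the tip of the secant moves, then its base. *)
Definition ncut (u v w : vertex) : Z :=
  cross (vsub v u) (vsub w u) + cross (vsub w u) (vsub w v).

(* This is 1 for a left turn and -1 for a right turn (see [nonback_turns]); [ncut]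
   corrects the jump of [edir] between 3 and -2. *)
Definition turn (u v w : vertex) : Z := edir v w - edir u v + 6 * ncut u v w.

Fixpoint tot (l : list vertex) : Z :=
  match l with
  | w :: ((v :: u :: _) as t) => turn u v w + tot t
  | _ => 0
  end.

(** The base case already contains the upward first step, so that every walk has an incoming
    direction to turn from. *)
Inductive rooted : list vertex -> Prop :=
| rooted_base : rooted [(0, 1); (0, 0)]
| rooted_cons w v l : rooted (v :: l) -> hex_adj v w -> ~ In w (v :: l) ->
    1 <= snd w -> rooted (w :: v :: l).

Lemma rooted_chain l : rooted l -> chain l.
Proof.
  induction 1 as [|w v l H IH A N Y].
  - simpl. auto 6.
  - split; auto.
Qed.

Lemma rooted_last l d : rooted l -> last l d = (0, 0).
Proof. induction 1; auto. Qed.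

Lemma rooted_row l v : rooted l -> In v l -> v = (0, 0) \/ 1 <= snd v.
Proof.
  induction 1 as [|w u l H IH A N Y]; simpl.
  - intros [<-|[<-|[]]]; simpl; auto; right; lia.
  - intros [<-|I]; auto.
Qed.

Lemma rooted_row0 l v : rooted l -> In v l -> 0 <= snd v.
Proof. intros H I. destruct (rooted_row l v H I); subst; simpl; lia. Qed.

Lemma rooted_NoDup l : rooted l -> NoDup l.
Proof.
  induction 1 as [|w u l H IH A N Y].
  - repeat constructor; simpl; intuition discriminate.
  - constructor; auto.
Qed.

Lemma cross_nonneg (u u' : vertex) : 0 <= snd u \/ 0 <= snd u' -> cross u u' = 0.
Proof. intro. destruct (cross_cases u u'); lia. Qed.

(* Moving the base point of the secants from [v] to [w] costs nothing at the start of
   the walk, which is its lowest point. *)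
Lemma tot_step u v w l :
  rooted (v :: u :: l) -> tot (v :: u :: l) = edir u v + 6 * cutsum v (u :: l) ->
  hex_adj v w -> ~ In w (v :: u :: l) -> 0 <= snd w ->
  tot (w :: v :: u :: l) = edir v w + 6 * cutsum w (v :: u :: l).
Proof.
  intros R E A N Y.
  assert (NV : ~ In v (u :: l)) by (apply rooted_NoDup in R; inversion R; auto).
  pose proof (cutsum_move v w u l (hex_adj_unit_step _ _ A)) as M.
  assert (Lst : last l u = (0, 0)).
  { rewrite <- (rooted_last _ u R), !last_cons_default. reflexivity. }
  change (tot (w :: v :: u :: l)) with (turn u v w + tot (v :: u :: l)).
  rewrite E, cutsum_cons2. unfold turn, ncut.
  rewrite Lst, (cross_nonneg (vsub v (0,0))) in M.
  - specialize (M (proj2 (rooted_chain _ R)) NV (fun h => N (or_intror h))). lia.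
  - left. unfold vsub; simpl. pose proof (rooted_row0 _ v R (or_introl eq_refl)). lia.
Qed.

(** The walk starts in direction 0, so its turning is a lift of its final direction [edir u v]. The
    secants to the last vertex determine which lift. *)
Lemma tot_rooted u v l :
  rooted (v :: u :: l) -> tot (v :: u :: l) = edir u v + 6 * cutsum v (u :: l).
Proof.
  intro H. remember (v :: u :: l) as m eqn:Em. revert u v l Em.
  induction H as [|w v l H IH A N Y]; intros u' v' l' Em; inversion Em; subst.
  - reflexivity.
  - destruct l' as [|u l']; [inversion H|]. apply tot_step; auto. lia.
Qed.

Lemma tot_exit v w l :
  rooted (v :: l) -> hex_adj v w -> ~ In w (v :: l) -> 0 <= snd w ->
  tot (w :: v :: l) = edir v w + 6 * cutsum w (v :: l).
Proof.
  intros R. destruct l as [|u l]; [inversion R|]. apply tot_step; auto using tot_rooted.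
Qed.

(** * Turning of walks that close a loop *)

Lemma rooted_tail a b c l : rooted (a :: b :: c :: l) -> rooted (b :: c :: l).
Proof. inversion 1; subst; auto. Qed.

Lemma rooted_suffix l a b m : rooted (l ++ a :: b :: m) -> rooted (a :: b :: m).
Proof.
  induction l as [|c l IH]; auto. intro H. apply IH. simpl app in H.
  destruct l as [|d [|e l]]; simpl app in *; eapply rooted_tail; exact H.
Qed.

(** On a closed walk the two boundary terms of [cutsum_move] coincide: the winding number around a
    point off the loop does not change when the point moves. *)
Lemma cutsum_loop_move (z z' v : vertex) (m : list vertex) :
  unit_step z z' -> chain (v :: m ++ [v]) -> ~ In z (v :: m) -> ~ In z' (v :: m) ->
  cutsum z' (v :: m ++ [v]) = cutsum z (v :: m ++ [v]).
Proof.
  intros U C N N'. pose proof (cutsum_move z z' v (m ++ [v]) U C) as M.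
  rewrite last_last in M.
  assert (I : forall x, In x (v :: m ++ [v]) -> In x (v :: m)).
  { intros x [->|H]; [left; auto|]. apply in_app_or in H as [H|[->|[]]]; simpl; auto. }
  specialize (M (fun h => N (I _ h)) (fun h => N' (I _ h))). lia.
Qed.

(* A loop attached at the end of a tail that starts below it does not wind around the tail. *)
Lemma cutsum_loop_tail (v p : vertex) (m tau : list vertex) :
  rooted (v :: p :: tau) -> chain (v :: m ++ [v]) ->
  (forall x, In x (v :: m) -> 1 <= snd x) ->
  (forall x, In x (v :: m) -> ~ In x (p :: tau)) ->
  cutsum p (v :: m ++ [v]) = 0.
Proof.
  intros R C Y D.
  (* The winding number vanishes around the origin, which lies below the loop, and stays constant
     while the base point follows the tail up to [p]. *)
  assert (Z0 : cutsum (0, 0) (v :: m ++ [v]) = 0).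
  { rewrite cutsum_below, last_last; [lia|]. intros b [<-|H].
    - specialize (Y v (or_introl eq_refl)). simpl; lia.
    - apply in_app_or in H as [H|[<-|[]]].
      + specialize (Y b (or_intror H)); simpl; lia.
      + specialize (Y v (or_introl eq_refl)). simpl; lia. }
  inversion R as [|? ? ? R' _ _ _ E]; subst; [exact Z0|].
  clear R. revert D. remember (p :: tau) as l eqn:El. revert p tau El.
  induction R' as [|w u l R' IH A N Yw]; intros p tau El D; inversion El; subst.
  - transitivity (cutsum (0, 0) (v :: m ++ [v])); [|exact Z0].
    apply cutsum_loop_move; auto.
    + right; simpl; lia.
    + intro I. apply (D _ I). simpl; auto.
    + intro I. apply (D _ I). simpl; auto.
  - rewrite <- (IH u l eq_refl).
    + apply cutsum_loop_move; auto.
      * apply hex_adj_unit_step; auto.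
      * intro I. apply (D _ I). simpl; auto.
      * intro I. apply (D _ I). simpl; auto.
    + intros x I I'. apply (D x I). right; auto.
Qed.


Ltac eval_comparisons :=
  repeat match goal with
  | |- context [(?a <? ?b)%Z] =>
    first [ replace (a <? b)%Z with true by (symmetry; apply Z.ltb_lt; lia)
          | replace (a <? b)%Z with false by (symmetry; apply Z.ltb_ge; lia) ]
  end.

Lemma even_neighbours x y :
  Z.even (x + 1 + y) = negb (Z.even (x + y)) /\ Z.even (x - 1 + y) = negb (Z.even (x + y)).
Proof.
  replace (x + 1 + y) with (Z.succ (x + y)) by lia.
  replace (x - 1 + y) with (Z.pred (x + y)) by lia.
  rewrite Z.even_succ, Z.even_pred, Z.negb_even. auto.
Qed.

(** What remains of [tot_loop] near [v], a finite check over the neighbours and the parity of [v].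
    The value can be read off a single face: the turn at [v] into the loop is followed by five
    opposite turns. *)
Lemma turn_loop_local (v p q r : vertex) :
  hex_adj v p -> hex_adj v q -> hex_adj v r -> p <> q -> p <> r -> q <> r ->
  edir r v - edir p v + 6 * (
    cross (vsub v q) (vsub p q) - cross (vsub v r) (vsub p r)
    - cross (vsub p v) (vsub p q) - cross (vsub p r) (vsub p v)
    + cross (vsub r q) (vsub v q) + cross (vsub r v) (vsub r q)
    + cross (vsub r p) (vsub r v) + cross (vsub v p) (vsub r p))
  = - 4 * turn p v q.
Proof.
  destruct v as [x y], p as [px py], q as [qx qy], r as [rx ry].
  unfold hex_adj.
  destruct (even_neighbours x y) as [E1 E2].
  intros Hp Hq Hr N1 N2 N3.
  unfold turn, ncut, cross, vsub, edir, xpos; cbn [fst snd].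
  destruct Hp as [[-> [-> | ->]] | [-> [[P ->] | [P ->]]]],
    Hq as [[-> [-> | ->]] | [-> [[Q ->] | [Q ->]]]],
    Hr as [[-> [-> | ->]] | [-> [[R ->] | [R ->]]]];
  try (exfalso; congruence); clear N1 N2 N3;
  rewrite ?E1, ?E2, ?P, ?Q, ?R;
  eval_comparisons; try reflexivity; simpl negb; cbv iota; destruct (Z.even (x + y)); reflexivity.
Qed.

(** By [tot_rooted] the turnings are secant sums. [M1] and [M2] move the base point between [r] and
    [v]; the sum over the loop is known from [p], around which the loop does not wind ([L]), and is
    carried to [v] by [M3]. Only terms between [v] and its neighbours survive. *)
Lemma tot_loop (v p q r : vertex) (rho tau : list vertex) :
  rooted (r :: rho ++ q :: v :: p :: tau) -> hex_adj r v ->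
  tot (v :: r :: rho ++ q :: v :: p :: tau) = tot (v :: p :: tau) - 4 * turn p v q.
Proof.
  intros R A.
  pose proof (rooted_chain _ R) as C. pose proof (rooted_NoDup _ R) as ND.
  assert (Rv : rooted (v :: p :: tau)).
  { apply (rooted_suffix (r :: rho ++ [q])). simpl. rewrite <- app_assoc. exact R. }
  assert (EL : r :: rho ++ q :: v :: p :: tau = (r :: rho ++ [q]) ++ v :: p :: tau).
  { simpl. rewrite <- app_assoc. reflexivity. }
  assert (D : forall x, In x (r :: rho ++ [q]) -> ~ In x (v :: p :: tau)).
  { rewrite EL in ND. intros x I I'. revert ND I I'. generalize (r :: rho ++ [q]) as l.
    generalize (v :: p :: tau). clear. intros m l; induction l as [|a l IH]; simpl; [tauto|].
    intros ND [->|I] I'; inversion ND; subst; auto. apply H1, in_or_app; auto. }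
  assert (Dv : ~ In v (p :: tau)).
  { pose proof (rooted_NoDup _ Rv) as H. inversion H; auto. }
  assert (Yv : 1 <= snd v).
  { destruct (rooted_row _ v Rv (or_introl eq_refl)) as [->|]; auto.
    exfalso. apply Dv. rewrite <- (rooted_last _ (0, 0) Rv), !last_cons_default.
    apply last_in. }
  assert (CL : chain (r :: rho ++ [q]) /\ chain (q :: v :: p :: tau)).
  { apply (chain_app (r :: rho)). exact C. }
  destruct CL as [CL [Aqv [Apv CT]]].
  assert (Lst : last tau p = (0, 0)).
  { rewrite <- (rooted_last _ v Rv), !last_cons_default. reflexivity. }
  assert (M1 : cutsum r (p :: tau) = cutsum v (p :: tau) + cross (vsub v p) (vsub r p)).
  { rewrite <- (cutsum_move v r p tau).
    - rewrite Lst, (cross_nonneg (vsub v (0,0))); [lia|]. left; unfold vsub; simpl; lia.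
    - apply hex_adj_unit_step, hex_adj_sym; auto.
    - exact CT.
    - exact Dv.
    - intro I. apply (D r (or_introl eq_refl)). right; auto. }
  assert (L : cutsum p (v :: (r :: rho ++ [q]) ++ [v]) = 0).
  { apply (cutsum_loop_tail v p _ tau Rv).
    - split; [exact A|].
      replace ((r :: rho ++ [q]) ++ [v]) with ((r :: rho) ++ q :: [v])
        by (simpl; rewrite <- app_assoc; reflexivity).
      apply chain_app. split; [exact CL|]. simpl; auto.
    - intros x [<-|I]; auto.
      destruct (rooted_row _ x R) as [->|]; auto.
      + rewrite EL. apply in_or_app; auto.
      + exfalso. apply (D _ I). right. rewrite <- Lst.
        apply last_in.
    - intros x [<-|I]; auto. intro I'. apply (D x I). right; auto. }
  assert (M3 : cutsum p (r :: rho ++ [q]) + cross (vsub v q) (vsub p q) =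
               cutsum v (r :: rho ++ [q]) + cross (vsub v r) (vsub p r)).
  { rewrite <- (cutsum_move v p r (rho ++ [q])).
    - rewrite last_last. reflexivity.
    - apply hex_adj_unit_step, hex_adj_sym; auto.
    - exact CL.
    - intro I. apply (D v I). left; auto.
    - intro I. apply (D p I). right; left; auto. }
  assert (L' : cutsum p (v :: (r :: rho ++ [q]) ++ [v]) =
    cross (vsub p r) (vsub p v) + cutsum p (r :: rho ++ [q]) + cross (vsub p v) (vsub p q)).
  { replace (v :: (r :: rho ++ [q]) ++ [v]) with (v :: r :: rho ++ q :: [v])
      by (simpl; rewrite <- app_assoc; reflexivity).
    rewrite cutsum_cons2, app_comm_cons, cutsum_app. cbn. lia. }
  assert (W : edir r v - edir p v + 6 * (cutsum v (r :: rho ++ [q])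
    + cross (vsub r q) (vsub v q) + cross (vsub r v) (vsub r q)
    + cross (vsub r p) (vsub r v) + cross (vsub v p) (vsub r p)) = - 4 * turn p v q).
  { rewrite <- (turn_loop_local v p q r); auto.
    - rewrite L in L'. lia.
    - apply hex_adj_sym; auto.
    - apply hex_adj_sym; auto.
    - intros ->. apply (D q); [right; apply in_or_app; simpl; auto|right; left; auto].
    - intros ->. apply (D r); [left; auto|right; left; auto].
    - intros ->. inversion ND; subst. apply H1, in_or_app; right; left; auto. }
  assert (S : exists s rho', rho ++ [q] = s :: rho').
  { destruct rho; simpl; eauto. }
  destruct S as [s [rho' ES]].
  assert (M2 : cutsum v (rho ++ [q]) + cross (vsub r q) (vsub v q) =
               cutsum r (rho ++ [q]) + cross (vsub r s) (vsub v s)).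
  { assert (Q : last rho' s = q).
    { rewrite <- (last_cons_default _ rho' s q), <- ES. apply last_last. }
    rewrite ES. rewrite <- (cutsum_move r v s rho').
    - rewrite Q. reflexivity.
    - apply hex_adj_unit_step; auto.
    - rewrite ES in CL. apply CL.
    - rewrite <- ES. inversion ND; subst. intro I; apply H1.
      apply in_app_or in I as [I|[->|[]]]; apply in_or_app; simpl; auto.
    - rewrite <- ES. intro I. apply (D v); [right|left]; auto. }
  assert (EF : rho ++ q :: v :: p :: tau = s :: rho' ++ v :: p :: tau).
  { change (rho ++ q :: v :: p :: tau) with (rho ++ [q] ++ (v :: p :: tau)).
    rewrite app_assoc, ES. reflexivity. }
  pose proof (tot_rooted p v tau Rv) as T0.
  assert (T1 : tot (r :: rho ++ q :: v :: p :: tau) =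
    edir s r + 6 * cutsum r (rho ++ q :: v :: p :: tau)).
  { rewrite EF in *. apply tot_rooted. exact R. }
  assert (T2 : tot (v :: r :: rho ++ q :: v :: p :: tau) =
    turn s r v + tot (r :: rho ++ q :: v :: p :: tau)).
  { rewrite EF. reflexivity. }
  assert (X : cutsum r (rho ++ q :: v :: p :: tau) = cutsum r (rho ++ [q])
    + cross (vsub r v) (vsub r q) + cross (vsub r p) (vsub r v) + cutsum r (p :: tau)).
  { rewrite cutsum_app, !cutsum_cons2. lia. }
  assert (Y : cutsum v (r :: rho ++ [q]) = cross (vsub v s) (vsub v r) + cutsum v (rho ++ [q])).
  { rewrite ES. apply cutsum_cons2. }
  unfold turn at 1 in T2. unfold ncut in T2. lia.
Qed.

Open Scope R_scope.

(** * Sums over enumerated walks *)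

Definition lsum {A : Type} (f : A -> R) (l : list A) : R :=
  fold_right (fun a s => f a + s) 0 l.

Lemma lsum_cons A (f : A -> R) a l : lsum f (a :: l) = f a + lsum f l.
Proof. reflexivity. Qed.

Lemma lsum_app A (f : A -> R) l m : lsum f (l ++ m) = lsum f l + lsum f m.
Proof. induction l as [|a l IH]; simpl; rewrite ?IH; lra. Qed.

Lemma lsum_ext A (f g : A -> R) l :
  (forall a, In a l -> f a = g a) -> lsum f l = lsum g l.
Proof.
  induction l as [|a l IH]; intro H; simpl; [reflexivity|].
  rewrite H, IH; simpl; auto. intros; apply H; simpl; auto.
Qed.

Lemma lsum_le A (f g : A -> R) l :
  (forall a, In a l -> f a <= g a) -> lsum f l <= lsum g l.
Proof.
  induction l as [|a l IH]; intro H; simpl; [lra|].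
  apply Rplus_le_compat; [apply H; simpl; auto|apply IH; intros; apply H; simpl; auto].
Qed.

Lemma lsum_nonneg A (f : A -> R) l : (forall a, In a l -> 0 <= f a) -> 0 <= lsum f l.
Proof.
  induction l as [|a l IH]; intro H; simpl; [lra|].
  apply Rplus_le_le_0_compat; [apply H; simpl; auto|apply IH; intros; apply H; simpl; auto].
Qed.

Lemma lsum_plus A (f g : A -> R) l : lsum (fun a => f a + g a) l = lsum f l + lsum g l.
Proof. induction l as [|a l IH]; simpl; rewrite ?IH; lra. Qed.

Lemma lsum_scal A c (f : A -> R) l : lsum (fun a => c * f a) l = c * lsum f l.
Proof. induction l as [|a l IH]; simpl; rewrite ?IH; lra. Qed.

Lemma lsum_const A c (l : list A) : lsum (fun _ => c) l = INR (length l) * c.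
Proof.
  induction l as [|a l IH]; [simpl; lra|].
  change (length (a :: l)) with (S (length l)).
  rewrite lsum_cons, IH, S_INR. lra.
Qed.

Lemma lsum_map A B (f : B -> R) (g : A -> B) l :
  lsum f (map g l) = lsum (fun a => f (g a)) l.
Proof. induction l as [|a l IH]; simpl; rewrite ?IH; reflexivity. Qed.

Lemma lsum_flat_map A B (f : B -> R) (g : A -> list B) l :
  lsum f (flat_map g l) = lsum (fun a => lsum f (g a)) l.
Proof. induction l as [|a l IH]; simpl; rewrite ?lsum_app, ?IH; reflexivity. Qed.

Lemma lsum_perm A (f : A -> R) l m : Permutation l m -> lsum f l = lsum f m.
Proof. induction 1; simpl; lra. Qed.

Lemma lsum_filter A (f : A -> R) (P : A -> bool) l :
  lsum f l = lsum f (filter P l) + lsum f (filter (fun a => negb (P a)) l).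
Proof. induction l as [|a l IH]; simpl; [lra|]. destruct (P a); simpl; lra. Qed.

(** The tool behind the cutting arguments: an injection of walks into pieces, or pairs of pieces,
    that controls the weights up to [C] yields an inequality of generating functions. *)
Lemma lsum_inject A B (f : A -> R) (g : B -> R) (phi : A -> B) C l m :
  NoDup l -> (forall a a', In a l -> In a' l -> phi a = phi a' -> a = a') ->
  (forall a, In a l -> In (phi a) m) -> (forall a, In a l -> f a <= C * g (phi a)) ->
  (forall b, In b m -> 0 <= g b) -> 0 <= C -> lsum f l <= C * lsum g m.
Proof.
  revert m. induction l as [|a l IH]; intros m ND Inj Im Le Pos HC.
  - simpl. apply Rmult_le_pos; auto. apply lsum_nonneg; auto.
  - inversion ND as [|? ? Na ND']; subst.
    destruct (in_split (phi a) m (Im a (or_introl eq_refl))) as [m1 [m2 E]].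
    rewrite lsum_cons, (lsum_perm _ g m (phi a :: m1 ++ m2)), lsum_cons.
    + rewrite Rmult_plus_distr_l. apply Rplus_le_compat; [apply Le; simpl; auto|].
      apply IH; auto.
      * intros; apply Inj; simpl; auto.
      * intros b Hb. assert (I := Im b (or_intror Hb)). rewrite E in I.
        apply in_app_or in I as [I|[I|I]]; [apply in_or_app; auto| |apply in_or_app; auto].
        exfalso. apply Na. rewrite (Inj a b); simpl; auto.
      * intros b Hb; apply Le; simpl; auto.
      * intros b Hb. apply Pos. rewrite E.
        apply in_app_or in Hb as [Hb|Hb]; apply in_or_app; simpl; auto.
    + rewrite E. symmetry. apply Permutation_middle.
Qed.

Lemma lsum_incl A (f : A -> R) l m :
  NoDup l -> incl l m -> (forall a, In a m -> 0 <= f a) -> lsum f l <= lsum f m.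
Proof.
  intros ND I Pos. rewrite <- (Rmult_1_l (lsum f m)).
  apply (lsum_inject _ _ f f (fun a => a)); auto; intros; lra.
Qed.

Lemma lsum_prod A B (f : A -> R) (g : B -> R) l m :
  lsum (fun p => f (fst p) * g (snd p)) (list_prod l m) = lsum f l * lsum g m.
Proof.
  induction l as [|a l IH]; simpl; [lra|].
  rewrite lsum_app, IH, lsum_map. simpl. rewrite lsum_scal. lra.
Qed.

(** * Enumeration of the walks in a domain by length *)

Definition vdec (p q : vertex) : {p = q} + {p <> q}.
Proof. decide equality; apply Z.eq_dec. Defined.

Definition memb (v : vertex) (l : list vertex) : bool :=
  if in_dec vdec v l then true else false.

Lemma memb_true v l : memb v l = true <-> In v l.
Proof. unfold memb. destruct (in_dec vdec v l); split; auto; discriminate. Qed.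

Lemma memb_false v l : memb v l = false <-> ~ In v l.
Proof. unfold memb. destruct (in_dec vdec v l); split; auto; try discriminate; tauto. Qed.

Definition nbrs (v : vertex) : list vertex :=
  let (x, y) := v in
  [(x + 1, y)%Z; (x - 1, y)%Z; (x, if Z.even (x + y) then y + 1 else y - 1)%Z].

Lemma in_nbrs v w : In w (nbrs v) <-> hex_adj v w.
Proof.
  destruct v as [x y], w as [x' y']; unfold hex_adj; simpl. split.
  - intros [E|[E|[E|[]]]]; injection E as <- <-; auto.
    right. split; auto. destruct (Z.even (x + y)); auto.
  - intros [[-> [-> | ->]]|[-> [[-> ->]|[-> ->]]]]; auto.
Qed.

Lemma NoDup_nbrs v : NoDup (nbrs v).
Proof.
  destruct v as [x y]; unfold nbrs. repeat constructor; simpl; auto;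
  intros H; repeat destruct H as [H|H]; auto; injection H; intros;
  destruct (Z.even (x + y)); lia.
Qed.

Definition ext (D : vertex -> bool) (g : list vertex) : list vertex :=
  match g with
  | v :: _ => filter (fun w => D w && negb (memb w g)) (nbrs v)
  | [] => []
  end.

Fixpoint gen (s : list vertex) (D : vertex -> bool) (n : nat) : list (list vertex) :=
  match n with
  | O => [s]
  | S n => flat_map (fun g => map (fun w => w :: g) (ext D g)) (gen s D n)
  end.

Lemma in_ext D v l w :
  In w (ext D (v :: l)) <-> hex_adj v w /\ D w = true /\ ~ In w (v :: l).
Proof.
  unfold ext. rewrite filter_In, in_nbrs, andb_true_iff, negb_true_iff, memb_false. tauto.
Qed.

Lemma in_gen_S s D n m :
  In m (gen s D (S n)) <-> exists w g, m = w :: g /\ In g (gen s D n) /\ In w (ext D g).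
Proof.
  simpl. rewrite in_flat_map. split.
  - intros [g [H1 H2]]. apply in_map_iff in H2 as [w [<- H2]]. eauto.
  - intros [w [g [-> [H1 H2]]]]. exists g. split; auto. apply (in_map (fun w => w :: g)); auto.
Qed.

Lemma NoDup_flat_map_cons (f : list vertex -> list vertex) l :
  NoDup l -> (forall g, NoDup (f g)) ->
  NoDup (flat_map (fun g => map (fun w => w :: g) (f g)) l).
Proof.
  intros H Hf. induction H as [|g l N H IH]; simpl; [constructor|].
  apply NoDup_app; auto.
  - apply FinFun.Injective_map_NoDup; auto. intros a b E; congruence.
  - intros m I I'. apply in_map_iff in I as [w [<- _]].
    apply in_flat_map in I' as [g' [I1 I2]].
    apply in_map_iff in I2 as [w' [E _]]. injection E as _ ->. auto.
Qed.

Lemma NoDup_ext D g : NoDup (ext D g).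
Proof. destruct g; [constructor|]. apply NoDup_filter, NoDup_nbrs. Qed.

Lemma NoDup_gen s D n : NoDup (gen s D n).
Proof.
  induction n as [|n IH]; simpl; [repeat constructor; auto|].
  apply NoDup_flat_map_cons; auto using NoDup_ext.
Qed.

Definition root : list vertex := [(0, 1); (0, 0)]%Z.

(** The start of the walk lies in row 0, outside the domains considered, and has to be exempted. *)
Definition within (D : vertex -> bool) (g : list vertex) : Prop :=
  forall v, In v g -> v = (0, 0)%Z \/ D v = true.

Lemma in_gen_root D n g :
  (forall v, D v = true -> (1 <= snd v)%Z) -> D (0, 1)%Z = true ->
  In g (gen root D n) <-> rooted g /\ within D g /\ length g = (n + 2)%nat.
Proof.
  intros HD H01. revert g. induction n as [|n IH]; intro g.
  - simpl. split.
    + intros [<-|[]]. repeat split; [constructor|].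
      intros v [<-|[<-|[]]]; auto.
    + intros [H1 [_ H2]]. inversion H1 as [|w v l Hl]; subst; auto.
      simpl in H2. inversion Hl; subst; simpl in *; lia.
  - rewrite in_gen_S. split.
    + intros [w [h [-> [H1 H2]]]]. apply IH in H1 as [H3 [H4 H5]].
      destruct h as [|v h]; [inversion H3|]. apply in_ext in H2 as [H6 [H7 H8]].
      repeat split.
      * constructor; auto.
      * intros u [<-|I]; auto.
      * simpl in *; lia.
    + intros [H1 [H2 H3]]. inversion H1 as [E|w v l Hl A N Y]; subst.
      * simpl in H3; lia.
      * exists w, (v :: l). repeat split; auto.
        -- apply IH. split; [exact Hl|split].
           ++ intros u I. apply H2; simpl; auto.
           ++ simpl in *; lia.
        -- apply in_ext. repeat split; auto.
           destruct (H2 w (or_introl eq_refl)) as [E|E]; [|exact E].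
           rewrite E in Y; simpl in Y; lia.
Qed.

Ltac eval_turns :=
  cbn [fst snd];
  repeat match goal with
  | H : Z.even ?e = _ |- context [Z.even ?e] => rewrite H
  end; cbn [negb]; eval_comparisons; split; reflexivity.

Definition nonback (g : list vertex) : list vertex :=
  match g with
  | v :: u :: _ => filter (fun w => if vdec w u then false else true) (nbrs v)
  | _ => []
  end.

Lemma in_nonback v u l w : In w (nonback (v :: u :: l)) <-> hex_adj v w /\ w <> u.
Proof.
  unfold nonback. rewrite filter_In, in_nbrs. destruct (vdec w u); intuition discriminate.
Qed.

Lemma NoDup_nonback g : NoDup (nonback g).
Proof. destruct g as [|v [|u l]]; try constructor. apply NoDup_filter, NoDup_nbrs. Qed.

Lemma nonback_turns v u l :
  hex_adj v u -> exists w1 w2, Permutation (nonback (v :: u :: l)) [w1; w2] /\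
    turn u v w1 = 1%Z /\ turn u v w2 = (-1)%Z.
Proof.
  destruct v as [x y], u as [ux uy]. unfold hex_adj. intro A.
  destruct (even_neighbours x y) as [E1 E2].
  unfold nonback, nbrs.
  assert (X : forall a b c, filter (fun w => if vdec w (ux, uy) then false else true) [a; b; c]
     = (if vdec a (ux, uy) then [] else [a]) ++ (if vdec b (ux, uy) then [] else [b])
     ++ (if vdec c (ux, uy) then [] else [c])).
  { intros a b c. simpl. destruct (vdec a (ux, uy)), (vdec b (ux, uy)), (vdec c (ux, uy)); auto. }
  rewrite X. clear X.
  unfold turn, ncut, cross, vsub, edir, xpos; cbn [fst snd].
  destruct (Z.even (x + y)) eqn:E;
  destruct A as [[-> [-> | ->]] | [-> [[P ->] | [P ->]]]]; try discriminate;
  repeat match goal with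
  | |- context [vdec ?a ?b] =>
    destruct (vdec a b) as [X|X];
    [try (exfalso; injection X; lia) | try (exfalso; apply X; f_equal; lia)]; clear X
  end; simpl app;
  match goal with
  | |- exists w1 w2, Permutation [?a; ?b] _ /\ _ =>
    (exists a, b; split; [apply Permutation_refl|]; eval_turns) ||
    (exists b, a; split; [apply perm_swap|]; eval_turns)
  end.
Qed.

(** * The observable *)

Definition wcos (t : Z) : R := cos (IZR t * (PI / 8)).
Definition xc : R := / (2 * cos (PI / 8)).

Lemma cos_PI8_pos : 0 < cos (PI / 8).
Proof. apply cos_gt_0; pose proof PI_RGT_0; lra. Qed.

Lemma xc_pos : 0 < xc.
Proof. apply Rinv_0_lt_compat. pose proof cos_PI8_pos; lra. Qed.

Lemma wcos_split t : wcos t = xc * (wcos (1 + t) + wcos (-1 + t)).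
Proof.
  unfold wcos, xc. rewrite !plus_IZR.
  replace ((1 + IZR t) * (PI / 8)) with (IZR t * (PI / 8) + PI / 8) by lra.
  replace ((-1 + IZR t) * (PI / 8)) with (IZR t * (PI / 8) - PI / 8) by lra.
  rewrite cos_plus, cos_minus. pose proof cos_PI8_pos. field. lra.
Qed.

Lemma wcos_level g v u l : g = v :: u :: l -> rooted g ->
  wcos (tot g) = xc * lsum (fun w => wcos (tot (w :: g))) (nonback g).
Proof.
  intros -> R. pose proof (rooted_chain _ R) as [A _].
  destruct (nonback_turns v u l (hex_adj_sym _ _ A)) as [w1 [w2 [P [T1 T2]]]].
  rewrite (lsum_perm _ _ _ _ P), wcos_split, !lsum_cons.
  assert (E : forall w, tot (w :: v :: u :: l) = (turn u v w + tot (v :: u :: l))%Z)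
    by reflexivity.
  rewrite !E, T1, T2. change (lsum _ []) with 0. ring.
Qed.

Definition exits (D : vertex -> bool) (g : list vertex) : list vertex :=
  filter (fun w => negb (D w)) (nonback g).

Definition closures (D : vertex -> bool) (g : list vertex) : list vertex :=
  filter (fun w => D w && memb w g) (nonback g).

Lemma nonback_split D v u l f : NoDup (v :: u :: l) ->
  lsum f (nonback (v :: u :: l)) = lsum f (ext D (v :: u :: l))
    + lsum f (exits D (v :: u :: l)) + lsum f (closures D (v :: u :: l)).
Proof.
  intros ND. set (g := v :: u :: l) in *.
  rewrite (lsum_filter _ f D (nonback g)).
  rewrite (lsum_filter _ f (fun w => memb w g) (filter D (nonback g))).
  fold (exits D g).
  rewrite (lsum_perm _ f (filter (fun w => memb w g) _) (closures D g)).
  - rewrite (lsum_perm _ f (filter (fun w => negb (memb w g)) _) (ext D g)); [lra|].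
    apply NoDup_Permutation; auto using NoDup_filter, NoDup_nonback, NoDup_ext.
    intro w. rewrite !filter_In, negb_true_iff, memb_false.
    pose proof (in_nonback v u l w) as In1. pose proof (in_ext D v (u :: l) w) as In2.
    fold g in In1, In2. rewrite In1, In2. split; [tauto|].
    intros [H1 [H2 H3]]. assert (w <> u) by (intros ->; apply H3; right; left; auto). tauto.
  - unfold closures. apply NoDup_Permutation; auto using NoDup_filter, NoDup_nonback.
    intro w. rewrite !filter_In, andb_true_iff. tauto.
Qed.

Fixpoint splitv (w : vertex) (l : list vertex) : list vertex * list vertex :=
  match l with
  | [] => ([], [])
  | a :: t => if vdec a w then ([], l) else let (x, y) := splitv w t in (a :: x, y)
  end.

(** For a walk whose head occurs again in its tail, this runs backwards through the final loop;
    [splitv] finds the earlier visit. *)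
Definition flip (m : list vertex) : list vertex :=
  match m with
  | w :: g => let (a, b) := splitv w g in w :: rev a ++ b
  | [] => []
  end.

Lemma splitv_app w a b : ~ In w a -> splitv w (a ++ w :: b) = (a, w :: b).
Proof.
  induction a as [|c a IH]; intro N; simpl.
  - destruct (vdec w w); congruence.
  - destruct (vdec c w) as [->|]; [simpl in N; tauto|]. rewrite IH; simpl in *; tauto.
Qed.

Lemma flip_app w a b : ~ In w a -> flip (w :: a ++ w :: b) = w :: rev a ++ w :: b.
Proof. intro N. unfold flip. rewrite splitv_app; auto. Qed.

Definition closed_walks (D : vertex -> bool) (n : nat) : list (list vertex) :=
  flat_map (fun g => map (fun w => w :: g) (closures D g)) (gen root D n).

Lemma rooted_app a l m :
  rooted (a :: m) -> chain (l ++ a :: m) -> NoDup (l ++ a :: m) ->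
  (forall x, In x l -> (1 <= snd x)%Z) -> rooted (l ++ a :: m).
Proof.
  intros R. induction l as [|b l IH]; auto. intros C ND Y.
  assert (C' : chain (l ++ a :: m)).
  { destruct l; [destruct C; auto|]. destruct C; auto. }
  assert (IH' : rooted (l ++ a :: m)).
  { apply IH; auto. - inversion ND; auto. - intros; apply Y; simpl; auto. }
  assert (X : exists c k, l ++ a :: m = c :: k) by (destruct l; simpl; eauto).
  destruct X as [c [k X]]. simpl. rewrite X in *. simpl in C, ND. rewrite X in *.
  constructor; auto.
  - destruct C; auto.
  - inversion ND; auto.
  - apply Y; simpl; auto.
Qed.

Lemma chain_rev l : chain l -> chain (rev l).
Proof.
  induction l as [|a [|b l] IH]; simpl; auto. intros [A C]. specialize (IH C).
  simpl in IH. rewrite <- app_assoc. apply (chain_app (rev l) b [a]). split; auto.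
  simpl. split; auto using hex_adj_sym.
Qed.

Section Level.
Variable D : vertex -> bool.
Hypothesis HD : forall v, D v = true -> (1 <= snd v)%Z.
Hypothesis H01 : D (0, 1)%Z = true.

Lemma in_closed_walks n m :
  In m (closed_walks D n) <-> exists v p q r rho tau,
    m = v :: r :: rho ++ q :: v :: p :: tau /\ hex_adj r v /\ D v = true /\
    In (r :: rho ++ q :: v :: p :: tau) (gen root D n).
Proof.
  unfold closed_walks. rewrite in_flat_map. split.
  - intros [g [Hg Hm]]. apply in_map_iff in Hm as [v [<- Hv]].
    pose proof Hg as Hg'. apply in_gen_root in Hg' as [R [W _]]; auto.
    destruct g as [|r [|s g]]; try (inversion R; fail).
    unfold closures in Hv. rewrite filter_In, in_nonback, andb_true_iff, memb_true in Hv.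
    destruct Hv as [[A N] [Dv I]].
    destruct I as [<-|[<-|I]]; [|congruence|].
    { exfalso. clear -A. destruct r as [x y]. unfold hex_adj in A. lia. }
    destruct (in_split v g I) as [g1 [g2 ->]].
    destruct g2 as [|p tau].
    { exfalso. pose proof (rooted_last _ v R) as L.
      change (r :: s :: g1 ++ [v]) with ((r :: s :: g1) ++ [v]) in L.
      rewrite last_last in L. subst v. apply HD in Dv; simpl in Dv; lia. }
    destruct (exists_last (l := s :: g1)) as [rho [q E]]; [discriminate|].
    exists v, p, q, r, rho, tau.
    assert (E' : r :: rho ++ q :: v :: p :: tau = r :: s :: g1 ++ v :: p :: tau).
    { change (s :: g1 ++ v :: p :: tau) with ((s :: g1) ++ v :: p :: tau).
      rewrite E, <- app_assoc. reflexivity. }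
    rewrite E'. auto.
  - intros [v [p [q [r [rho [tau [-> [A [Dv Hg]]]]]]]]].
    exists (r :: rho ++ q :: v :: p :: tau). split; auto.
    apply in_map_iff. exists v. split; auto.
    apply in_gen_root in Hg as [R [W _]]; auto.
    pose proof (rooted_NoDup _ R) as ND.
    assert (X : exists s k, rho ++ [q] = s :: k) by (destruct rho; simpl; eauto).
    destruct X as [s [k X]].
    assert (X' : rho ++ q :: v :: p :: tau = s :: k ++ v :: p :: tau).
    { change (q :: v :: p :: tau) with ([q] ++ v :: p :: tau). rewrite app_assoc, X; auto. }
    rewrite X' in *.
    unfold closures. rewrite filter_In, in_nonback, andb_true_iff, memb_true.
    repeat split; auto.
    + intros ->. inversion ND as [|? ? _ ND']; subst. inversion ND' as [|? ? N _]; subst.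
      apply N. apply in_or_app; simpl; auto.
    + simpl. right; right. apply in_or_app; simpl; auto.
Qed.

Lemma flip_closed n m : In m (closed_walks D n) ->
  In (flip m) (closed_walks D n) /\ flip (flip m) = m /\
  wcos (tot (flip m)) = - wcos (tot m).
Proof.
  intro H. apply in_closed_walks in H as [v [p [q [r [rho [tau [-> [A [Dv Hg]]]]]]]]].
  pose proof Hg as Hg'. apply in_gen_root in Hg as [R [W Len]]; auto.
  pose proof (rooted_NoDup _ R) as ND. pose proof (rooted_chain _ R) as C.
  assert (E1 : r :: rho ++ q :: v :: p :: tau = (r :: rho ++ [q]) ++ v :: p :: tau).
  { simpl. rewrite <- app_assoc. reflexivity. }
  assert (E2 : rev (r :: rho ++ [q]) ++ v :: p :: tau = q :: rev rho ++ r :: v :: p :: tau).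
  { simpl. rewrite rev_app_distr. simpl. rewrite <- app_assoc. reflexivity. }
  assert (Nv : ~ In v (r :: rho ++ [q])).
  { rewrite E1 in ND. apply NoDup_remove_2 in ND. intro I. apply ND, in_or_app; auto. }
  assert (F : flip (v :: r :: rho ++ q :: v :: p :: tau) =
              v :: q :: rev rho ++ r :: v :: p :: tau).
  { rewrite E1, flip_app, E2; auto. }
  assert (Rv : rooted (v :: p :: tau)).
  { apply (rooted_suffix (r :: rho ++ [q])). rewrite <- E1; auto. }
  assert (PR : Permutation (r :: rho ++ q :: v :: p :: tau) (q :: rev rho ++ r :: v :: p :: tau)).
  { rewrite E1, <- E2. apply Permutation_app_tail, Permutation_rev. }
  assert (CC : chain (r :: rho ++ [q]) /\ chain (q :: v :: p :: tau)).
  { apply (chain_app (r :: rho)). exact C. }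
  destruct CC as [C1 C2].
  assert (Cr : chain (q :: rev rho ++ r :: v :: p :: tau)).
  { apply (chain_app (q :: rev rho) r). split.
    - apply chain_rev in C1. simpl in C1. rewrite rev_app_distr in C1. exact C1.
    - split; [apply hex_adj_sym; auto|apply C2]. }
  assert (R' : rooted (q :: rev rho ++ r :: v :: p :: tau)).
  { rewrite <- E2. apply rooted_app; rewrite ?E2; auto.
    - apply (Permutation_NoDup PR ND).
    - intros x I. apply in_rev in I.
      destruct (rooted_row _ x R) as [->|]; auto.
      + rewrite E1. apply in_or_app; auto.
      + exfalso. rewrite E1 in ND.
        assert (I0 : In (0,0)%Z (p :: tau)).
        { rewrite <- (rooted_last _ v Rv), !last_cons_default. apply last_in. }
        clear -ND I I0. revert ND I. generalize (r :: rho ++ [q]) as l.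
        induction l as [|a l IH]; simpl; [tauto|].
        intros ND [->|I]; inversion ND; subst; auto.
        apply H1, in_or_app. right. right. auto. }
  assert (Hf : In (flip (v :: r :: rho ++ q :: v :: p :: tau)) (closed_walks D n)).
  { rewrite F. apply in_closed_walks. exists v, p, r, q, (rev rho), tau.
    repeat split; auto.
    - destruct C2; apply hex_adj_sym; auto.
    - apply in_gen_root; auto. split; [auto|split].
      + intros x I. apply W. apply (Permutation_in _ (Permutation_sym PR)); auto.
      + rewrite <- Len. symmetry. apply Permutation_length; auto. }
  split; [exact Hf|]. split.
  - rewrite E1, flip_app, flip_app, rev_involutive; auto.
    rewrite <- in_rev; auto.
  - rewrite F, !tot_loop; auto; [|destruct C2; apply hex_adj_sym; auto].
    assert (Np : p <> q).
    { intros ->. rewrite app_comm_cons in ND. apply NoDup_remove_2 in ND.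
      apply ND. apply in_or_app; right; right; left; auto. }
    assert (Npr : p <> r).
    { intros ->. inversion ND; subst. apply H1, in_or_app; right; right; right; left; auto. }
    assert (Nqr : q <> r).
    { intros ->. inversion ND; subst. apply H1, in_or_app; right; left; auto. }
    destruct C2 as [Aqv [Avp _]].
    assert (S : (turn p v q = 1 /\ turn p v r = -1 \/ turn p v q = -1 /\ turn p v r = 1)%Z).
    { destruct (nonback_turns v p tau (hex_adj_sym _ _ Avp)) as [w1 [w2 [P [T1 T2]]]].
      assert (Iq : In q [w1; w2]).
      { apply (Permutation_in _ P), in_nonback. split; auto using hex_adj_sym. }
      assert (Ir : In r [w1; w2]).
      { apply (Permutation_in _ P), in_nonback. split; auto using hex_adj_sym. }
      simpl in Iq, Ir. destruct Iq as [<-|[<-|[]]], Ir as [<-|[<-|[]]]; tauto. }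
    generalize (tot (v :: p :: tau)). intro t.
    assert (K : forall s : Z, wcos (s - 4) = - wcos (s + 4)).
    { intro s. unfold wcos. rewrite minus_IZR, plus_IZR.
      replace ((IZR s - 4) * (PI / 8)) with (IZR s * (PI / 8) - PI / 2) by lra.
      replace ((IZR s + 4) * (PI / 8)) with (IZR s * (PI / 8) + PI / 2) by lra.
      rewrite cos_plus, cos_minus, cos_PI2. lra. }
    specialize (K t).
    destruct S as [[-> ->]|[-> ->]]; [rewrite <- (Ropp_involutive (wcos (t - 4 * -1)))|];
      change (4 * 1)%Z with 4%Z; change (4 * -1)%Z with (-4)%Z;
      replace (t - -4)%Z with (t + 4)%Z by lia; lra.
Qed.

Lemma NoDup_closed_walks n : NoDup (closed_walks D n).
Proof.
  apply NoDup_flat_map_cons; [apply NoDup_gen|].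
  intro g. apply NoDup_filter, NoDup_nonback.
Qed.

(* Traversing the final loop backwards changes the total turning by 8, hence the phase
   by pi. *)
Lemma closed_walks_cancel n : lsum (fun m => wcos (tot m)) (closed_walks D n) = 0.
Proof.
  assert (P : Permutation (closed_walks D n) (map flip (closed_walks D n))).
  { symmetry. apply NoDup_Permutation_bis.
    - apply NoDup_map_NoDup_ForallPairs; [|apply NoDup_closed_walks].
      intros a b Ha Hb E. destruct (flip_closed n a Ha) as [_ [<- _]].
      destruct (flip_closed n b Hb) as [_ [<- _]]. rewrite E. reflexivity.
    - rewrite length_map. auto.
    - intros m Hm. apply in_map_iff in Hm as [m' [<- Hm]]. apply flip_closed; auto. }
  set (f := fun m => wcos (tot m)).
  assert (E : lsum f (closed_walks D n) = - lsum f (closed_walks D n)).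
  { rewrite (lsum_perm _ f _ _ P) at 1. rewrite lsum_map.
    replace (- lsum f (closed_walks D n)) with (-1 * lsum f (closed_walks D n)) by lra.
    rewrite <- lsum_scal. apply lsum_ext. intros m Hm.
    unfold f. destruct (flip_closed n m Hm) as [_ [_ ->]]. lra. }
  lra.
Qed.

Definition bd (g : list vertex) : R := lsum (fun w => wcos (tot (w :: g))) (exits D g).

Lemma level_step n :
  lsum (fun g => wcos (tot g)) (gen root D n) =
  xc * (lsum bd (gen root D n) + lsum (fun g => wcos (tot g)) (gen root D (S n))).
Proof.
  assert (E : forall g, In g (gen root D n) -> wcos (tot g) =
    xc * (lsum (fun w => wcos (tot (w :: g))) (ext D g)
      + bd g + lsum (fun w => wcos (tot (w :: g))) (closures D g))).
  { intros g Hg. apply in_gen_root in Hg as [R _]; auto.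
    destruct g as [|v [|u l]]; try (inversion R; fail).
    rewrite (wcos_level _ v u l eq_refl R). f_equal.
    apply nonback_split. apply rooted_NoDup; auto. }
  rewrite (lsum_ext _ _ _ _ E), lsum_scal, !lsum_plus.
  simpl gen. rewrite lsum_flat_map.
  rewrite (lsum_ext _ (fun g => lsum _ (map _ (ext D g)))
    (fun g => lsum (fun w => wcos (tot (w :: g))) (ext D g)))
    by (intros; apply lsum_map).
  pose proof (closed_walks_cancel n) as C. unfold closed_walks in C.
  rewrite lsum_flat_map in C.
  rewrite (lsum_ext _ (fun g => lsum _ (map _ (closures D g)))
    (fun g => lsum (fun w => wcos (tot (w :: g))) (closures D g))) in C
    by (intros; apply lsum_map).
  rewrite C. lra.
Qed.

(** By [level_step] the left side does not depend on [K], and for [K = 0] it is the weight of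
    [root]. The exponent [S k] counts the exit step but not the step from the origin, hence equals
    the length of the walk before its exit. *)
Lemma level_identity K :
  lsum (fun k => xc ^ (S k) * lsum bd (gen root D k)) (seq 0 K)
  + xc ^ K * lsum (fun g => wcos (tot g)) (gen root D K) = 1.
Proof.
  induction K as [|K IH].
  - simpl. unfold wcos. simpl. rewrite Rmult_0_l, cos_0. lra.
  - rewrite seq_S, lsum_app, <- IH, (level_step K). simpl. lra.
Qed.

End Level.

(** * Exits of a domain and their turning numbers *)

Definition veven (v : vertex) : bool := Z.even (fst v + snd v).

Lemma hex_adj_cases v w : hex_adj v w ->
  (snd w = snd v /\ (fst w = fst v + 1 \/ fst w = fst v - 1) \/
   veven v = true /\ fst w = fst v /\ snd w = snd v + 1 \/
   veven v = false /\ fst w = fst v /\ snd w = snd v - 1)%Z.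
Proof. destruct v, w; unfold hex_adj, veven; simpl. intuition. Qed.

Lemma hex_adj_up v : veven v = true -> hex_adj v (fst v, snd v + 1)%Z.
Proof. destruct v; unfold hex_adj, veven; simpl; auto. Qed.

Lemma hex_adj_down v : veven v = false -> hex_adj v (fst v, snd v - 1)%Z.
Proof. destruct v; unfold hex_adj, veven; simpl; auto. Qed.

Lemma rooted_head v l : rooted (v :: l) -> (1 <= snd v)%Z.
Proof. inversion 1; subst; auto. simpl; lia. Qed.

Lemma rooted_first_step g : rooted g -> In (0, 1)%Z g.
Proof. induction 1; simpl; auto. Qed.

(** Secants to a vertex as high as all others never point downwards, so they miss the ray. *)
Lemma cutsum_above (z : vertex) (l : list vertex) :
  (forall a, In a l -> (snd a <= snd z)%Z) -> cutsum z l = 0%Z.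
Proof.
  induction l as [|a [|b l] IH]; intro H; auto.
  rewrite cutsum_cons2, cross_nonneg, IH; auto.
  - intros; apply H; right; auto.
  - left. specialize (H b (or_intror (or_introl eq_refl))). unfold vsub; simpl; lia.
Qed.

Lemma cutsum_side (z : vertex) k (l : list vertex) :
  (forall a, In a l -> xpos (vsub z a) = k) -> cutsum z l = 0%Z.
Proof.
  induction l as [|a [|b l] IH]; intro H; auto.
  rewrite cutsum_cons2, IH by (intros; apply H; right; auto).
  pose proof (H a (or_introl eq_refl)). pose proof (H b (or_intror (or_introl eq_refl))).
  destruct (cross_cases (vsub z b) (vsub z a)); lia.
Qed.

(** Secants to row 0 point downwards and their crossings telescope, except that the secant from the
    origin is horizontal; the sum therefore ends at (0, 1). *)
Lemma cutsum_bottom w v l : rooted (v :: l) -> snd w = 0%Z ->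
  cutsum w (v :: l) = (xpos (vsub w v) - xpos (vsub w (0, 1)))%Z.
Proof.
  intros H Hw. remember (v :: l) as g eqn:E. revert v l E.
  induction H as [|u v l H IH A N Y]; intros v' l' E; injection E as <- <-.
  - rewrite cutsum_cons2, cross_nonneg; [simpl; lia|]. left; unfold vsub; simpl; lia.
  - rewrite cutsum_cons2, (IH v l eq_refl).
    pose proof (rooted_head _ _ H).
    destruct (cross_cases (vsub w v) (vsub w u)) as [C|C]; unfold vsub in *; simpl in *; lia.
Qed.

Lemma tot_exit_top v l w : rooted (v :: l) -> hex_adj v w ->
  (forall a, In a (v :: l) -> (snd a < snd w)%Z) -> tot (w :: v :: l) = 0%Z.
Proof.
  intros R A H. pose proof (rooted_head _ _ R).
  assert (Hv := H v (or_introl eq_refl)).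
  rewrite tot_exit; auto; try lia.
  - rewrite cutsum_above by (intros a I; specialize (H a I); lia).
    unfold edir. destruct (Z.ltb_spec (snd v) (snd w)); lia.
  - intro I. specialize (H w I). lia.
Qed.

Lemma tot_exit_right v l w : rooted (v :: l) -> hex_adj v w ->
  (forall a, In a (v :: l) -> (fst a < fst w)%Z) -> (-2 <= tot (w :: v :: l) <= -1)%Z.
Proof.
  intros R A H. pose proof (rooted_head _ _ R).
  assert (Hv := H v (or_introl eq_refl)). pose proof (hex_adj_cases _ _ A).
  rewrite tot_exit; auto; try lia.
  - rewrite (cutsum_side w 1).
    + unfold edir. destruct (Z.ltb_spec (snd v) (snd w)), (Z.ltb_spec (snd w) (snd v)),
      (Z.ltb_spec (fst v) (fst w)), (Z.even (fst v + snd v)); lia.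
    + intros a I. specialize (H a I). destruct (xpos_cases (vsub w a)) as [C|C];
      unfold vsub in *; simpl in *; lia.
  - intro I. specialize (H w I). lia.
Qed.

Lemma tot_exit_left v l w : rooted (v :: l) -> hex_adj v w ->
  (forall a, In a (v :: l) -> (fst w < fst a)%Z) -> (1 <= tot (w :: v :: l) <= 2)%Z.
Proof.
  intros R A H. pose proof (rooted_head _ _ R).
  assert (Hv := H v (or_introl eq_refl)). pose proof (hex_adj_cases _ _ A).
  rewrite tot_exit; auto; try lia.
  - rewrite (cutsum_side w 0).
    + unfold edir. destruct (Z.ltb_spec (snd v) (snd w)), (Z.ltb_spec (snd w) (snd v)),
      (Z.ltb_spec (fst v) (fst w)), (Z.even (fst v + snd v)); lia.
    + intros a I. specialize (H a I). destruct (xpos_cases (vsub w a)) as [C|C];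
      unfold vsub in *; simpl in *; lia.
  - intro I. specialize (H w I). lia.
Qed.

(** The final direction is opposite to the first one. An exit on the left of the origin has turned
    by +180 degrees, one on the right by -180 degrees. *)
Lemma tot_exit_bottom v l w : rooted (v :: l) -> hex_adj v w -> snd w = 0%Z ->
  w <> (0, 0)%Z -> tot (w :: v :: l) = 3%Z \/ tot (w :: v :: l) = (-3)%Z.
Proof.
  intros R A H N. pose proof (rooted_head _ _ R). pose proof (hex_adj_cases _ _ A).
  rewrite tot_exit; auto; try lia.
  - rewrite cutsum_bottom; auto. unfold edir.
    destruct (Z.ltb_spec (snd v) (snd w)), (Z.ltb_spec (snd w) (snd v)); try lia.
    destruct (xpos_cases (vsub w v)) as [C|C], (xpos_cases (vsub w (0,1)%Z)) as [C'|C'];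
    unfold vsub in *; cbn [fst snd] in *; lia.
  - intro I. destruct (rooted_row _ w R I) as [->|]; [tauto|lia].
Qed.

(** The weight of an exit through the bottom, whose turning is 3 or -3. *)
Definition ca : R := cos (3 * (PI / 8)).

Lemma ca_pos : 0 < ca.
Proof. apply cos_gt_0; pose proof PI_RGT_0; lra. Qed.

Lemma wcos_0 : wcos 0 = 1.
Proof. unfold wcos. rewrite Rmult_0_l. apply cos_0. Qed.

Lemma wcos_3 t : t = 3%Z \/ t = (-3)%Z -> wcos t = ca.
Proof.
  intros [-> | ->]; unfold wcos, ca; [reflexivity|].
  replace (-3 * (PI / 8)) with (- (3 * (PI / 8))) by lra. apply cos_neg.
Qed.

Lemma wcos_pos t : (-3 <= t <= 3)%Z -> 0 < wcos t.
Proof.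
  intros [H1%IZR_le H2%IZR_le]. unfold wcos. pose proof PI_RGT_0.
  apply cos_gt_0; nra.
Qed.

Definition strip (T : Z) (v : vertex) : bool := ((1 <=? snd v) && (snd v <=? T))%Z.

Definition rect (T L : Z) (v : vertex) : bool :=
  (strip T v && ((- L <=? fst v) && (fst v <=? L)))%Z.

Lemma strip_true T v : strip T v = true <-> (1 <= snd v <= T)%Z.
Proof. unfold strip. rewrite andb_true_iff, !Z.leb_le. tauto. Qed.

Lemma strip_false T v : strip T v = false <-> ~ (1 <= snd v <= T)%Z.
Proof. rewrite <- strip_true. destruct (strip T v); intuition discriminate. Qed.

Lemma rect_true T L v :
  rect T L v = true <-> (1 <= snd v <= T)%Z /\ (- L <= fst v <= L)%Z.
Proof. unfold rect. rewrite !andb_true_iff, strip_true, !Z.leb_le. tauto. Qed.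

(** Only an even vertex has an upward edge, so these are the walks in the strip that can leave it
    through the top at their next step. *)
Definition top_end (T : Z) (g : list vertex) : bool :=
  match g with v :: _ => veven v && (snd v =? T)%Z | [] => false end.

(* The condition on [u] excludes the initial walk, which cannot leave downwards without
   backtracking. *)
Definition bottom_end (g : list vertex) : bool :=
  match g with
  | v :: u :: _ => negb (veven v) && ((snd v =? 1) && (1 <=? snd u))%Z
  | _ => false
  end.

Definition b2r (b : bool) : R := if b then 1 else 0.

Lemma in_exits D v u l w :
  In w (exits D (v :: u :: l)) <-> hex_adj v w /\ w <> u /\ D w = false.
Proof. unfold exits. rewrite filter_In, in_nonback, negb_true_iff. tauto. Qed.

Lemma NoDup_exits D g : NoDup (exits D g).
Proof. apply NoDup_filter, NoDup_nonback. Qed.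

Lemma all_out_nil (A : Type) (l : list A) : (forall a, ~ In a l) -> l = [].
Proof. destruct l as [|a l]; auto. intro H. destruct (H a); left; auto. Qed.

Lemma vertex_eq (v w : vertex) : fst v = fst w -> snd v = snd w -> v = w.
Proof. destruct v, w; simpl; congruence. Qed.

Lemma bd_strip T v u l :
  (1 <= T)%Z -> rooted (v :: u :: l) -> within (strip T) (v :: u :: l) ->
  bd (strip T) (v :: u :: l) = b2r (top_end T (v :: u :: l))
    + ca * b2r (bottom_end (v :: u :: l)).
Proof.
  intros HT R W. pose proof (rooted_head _ _ R) as Yv.
  assert (Sv : (1 <= snd v <= T)%Z).
  { destruct (W v (or_introl eq_refl)) as [->|H]; [simpl in Yv; lia|].
    apply strip_true; auto. }
  assert (Su : (0 <= snd u <= T)%Z).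
  { destruct (W u (or_intror (or_introl eq_refl))) as [->|H]; [simpl; lia|].
    apply strip_true in H; lia. }
  pose proof (rooted_chain _ R) as [Auv _]. apply hex_adj_sym in Auv.
  pose proof (hex_adj_cases _ _ Auv) as Cu.
  unfold bd, top_end, bottom_end.
  destruct (veven v) eqn:Ev; simpl andb; simpl negb; cbv iota.
  - destruct (Z.eqb_spec (snd v) T) as [E|E].
    + rewrite (lsum_perm _ _ _ [(fst v, snd v + 1)%Z]).
      * rewrite lsum_cons, tot_exit_top, wcos_0; simpl; auto using hex_adj_up; try lra.
        intros a I. destruct (W a I) as [->|H]; [simpl; lia|].
        apply strip_true in H. lia.
      * apply NoDup_Permutation; [apply NoDup_exits|repeat constructor; auto|].
        intro w. rewrite in_exits, strip_false. split.
        -- intros [A [N H]]. left. pose proof (hex_adj_cases _ _ A).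
           apply vertex_eq; simpl; destruct (veven v); try discriminate; lia.
        -- intros [<-|[]]. repeat split; auto using hex_adj_up.
           ++ intros <-. simpl in Su; lia.
           ++ simpl; lia.
    + rewrite (all_out_nil _ (exits _ _)); [simpl; lra|].
      intros w I. rewrite in_exits, strip_false in I. destruct I as [A [N H]].
      pose proof (hex_adj_cases _ _ A); destruct (veven v); try discriminate; lia.
  - destruct (Z.eqb_spec (snd v) 1) as [E|E]; [destruct (Z.leb_spec 1 (snd u)) as [F|F]|];
      simpl andb; cbv iota.
    + rewrite (lsum_perm _ _ _ [(fst v, snd v - 1)%Z]).
      * rewrite lsum_cons, wcos_3; [unfold b2r; change (lsum _ []) with 0; lra|].
        apply tot_exit_bottom; auto using hex_adj_down.
        -- simpl; lia.
        (* An exit to the origin would come from (0, 1), where only the initial walk ends. *)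
        -- intro X. injection X as X1 X2.
           assert (v = (0, 1)%Z) by (apply vertex_eq; simpl; lia).
           subst v. inversion R as [Eb|? ? ? R' A' N' ? Eb]; subst; [simpl in F; lia|].
           apply N'. apply rooted_first_step; auto.
      * apply NoDup_Permutation; [apply NoDup_exits|repeat constructor; auto|].
        intro w. rewrite in_exits, strip_false. split.
        -- intros [A [N H]]. left. pose proof (hex_adj_cases _ _ A).
           apply vertex_eq; simpl; destruct (veven v); try discriminate; lia.
        -- intros [<-|[]]. repeat split; auto using hex_adj_down.
           ++ intros <-. simpl in F; lia.
           ++ simpl; lia.
    + rewrite (all_out_nil _ (exits _ _)); [simpl; lra|].
      intros w I. rewrite in_exits, strip_false in I. destruct I as [A [N H]].
      pose proof (hex_adj_cases _ _ A); destruct (veven v); try discriminate.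
      apply N. apply vertex_eq; lia.
    + rewrite (all_out_nil _ (exits _ _)); [simpl; lra|].
      intros w I. rewrite in_exits, strip_false in I. destruct I as [A [N H]].
      pose proof (hex_adj_cases _ _ A); destruct (veven v); try discriminate; lia.
Qed.

Lemma bd_rect T L v u l :
  (1 <= T)%Z -> (0 <= L)%Z -> rooted (v :: u :: l) -> within (rect T L) (v :: u :: l) ->
  b2r (top_end T (v :: u :: l)) <= bd (rect T L) (v :: u :: l).
Proof.
  intros HT HL R W. pose proof (rooted_head _ _ R) as Yv.
  assert (WS : forall a, In a (v :: u :: l) -> (0 <= snd a <= T /\ - L <= fst a <= L)%Z).
  { intros a I. destruct (W a I) as [->|H]; [simpl; lia|].
    apply rect_true in H. lia. }
  assert (Sv := WS v (or_introl eq_refl)).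
  assert (Su := WS u (or_intror (or_introl eq_refl))).
  assert (TOP : forall w, hex_adj v w -> (T < snd w)%Z -> tot (w :: v :: u :: l) = 0%Z).
  { intros w A Hw. apply tot_exit_top; auto. intros a I. specialize (WS a I). lia. }
  assert (Pos : forall w, In w (exits (rect T L) (v :: u :: l)) ->
            0 <= wcos (tot (w :: v :: u :: l))).
  { intros w I. apply in_exits in I as [A [N H]].
    assert (H' : ~ ((1 <= snd w <= T)%Z /\ (- L <= fst w <= L)%Z))
      by (rewrite <- rect_true, H; discriminate).
    pose proof (hex_adj_cases _ _ A) as C.
    apply Rlt_le, wcos_pos.
    destruct (Z.lt_ge_cases T (snd w)) as [G|G]; [rewrite TOP; auto; lia|].
    destruct (Z.lt_ge_cases L (fst w)) as [G'|G'].
    { assert (-2 <= tot (w :: v :: u :: l) <= -1)%Z; [|lia].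
      apply tot_exit_right; auto. intros a I; specialize (WS a I); lia. }
    destruct (Z.lt_ge_cases (fst w) (- L)) as [G2|G2].
    { assert (1 <= tot (w :: v :: u :: l) <= 2)%Z; [|lia].
      apply tot_exit_left; auto. intros a I; specialize (WS a I); lia. }
    destruct (vdec w (0, 0)%Z) as [->|N0].
    - assert (E : v = (0, 1)%Z) by (apply vertex_eq; simpl in *; lia).
      subst v. exfalso. inversion R as [Eb|? ? ? R' A' N' ? Eb]; subst; [tauto|].
      apply N'. apply rooted_first_step; auto.
    - destruct (tot_exit_bottom v (u :: l) w); auto; lia. }
  unfold bd. destruct (top_end T (v :: u :: l)) eqn:E; [|apply lsum_nonneg; auto].
  simpl in E. apply andb_true_iff in E as [E1 E2%Z.eqb_eq].
  set (w := (fst v, snd v + 1)%Z).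
  assert (I : In w (exits (rect T L) (v :: u :: l))).
  { apply in_exits. repeat split.
    - apply hex_adj_up; auto.
    - intros <-. simpl in Su; lia.
    - apply not_true_iff_false. rewrite rect_true. simpl; lia. }
  apply in_split in I as [l1 [l2 I]]. rewrite I in *.
  rewrite lsum_app, lsum_cons, TOP, wcos_0.
  - unfold b2r. apply (Rle_trans _ (0 + (1 + 0))); [lra|].
    apply Rplus_le_compat; [|apply Rplus_le_compat_l]; apply lsum_nonneg;
      intros a Ha; apply Pos, in_or_app; simpl; auto.
  - apply hex_adj_up; auto.
  - simpl; lia.
Qed.

(** * Bridges and arcs in strips *)

Definition walk0 (g : list vertex) : Prop :=
  (exists h, g = h ++ [(0, 0)%Z]) /\ chain g /\ NoDup g.

Definition saws (n : nat) : list (list vertex) := gen [(0, 0)%Z] (fun _ => true) n.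

Definition upto (N : nat) : list (list vertex) := flat_map saws (seq 0 (S N)).

Lemma walk0_cons w v l :
  walk0 (w :: v :: l) <-> walk0 (v :: l) /\ hex_adj v w /\ ~ In w (v :: l).
Proof.
  unfold walk0. split.
  - intros [[h E] [[A C] ND]]. inversion ND; subst. repeat split; auto.
    destruct h as [|a h]; [discriminate|]. injection E as -> E. eauto.
  - intros [[[h E] [C ND]] [A N]]. repeat split; auto.
    + exists (w :: h). simpl. f_equal. exact E.
    + constructor; auto.
Qed.

Lemma walk0_single v : walk0 [v] <-> v = (0, 0)%Z.
Proof.
  split.
  - intros [[[|a [|b h]] E] _]; simpl in E; try discriminate; congruence.
  - intros ->. split; [exists []; auto|]. split; simpl; auto. repeat constructor; auto.
Qed.

Lemma in_saws n g : In g (saws n) <-> walk0 g /\ length g = S n.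
Proof.
  revert g. unfold saws. induction n as [|n IH]; intro g.
  - simpl. split.
    + intros [<-|[]]. split; auto. apply walk0_single; auto.
    + intros [H L]. destruct g as [|v [|u l]]; try discriminate.
      apply walk0_single in H. subst; auto.
  - rewrite in_gen_S. split.
    + intros [w [h [-> [H1 H2]]]]. apply IH in H1 as [H3 H4].
      destruct h as [|v h]; [discriminate|]. apply in_ext in H2 as [H5 [_ H6]].
      split; [apply walk0_cons; auto|]. simpl in *; lia.
    + intros [H L]. destruct g as [|w [|v l]]; try discriminate.
      apply walk0_cons in H as [H [A N]]. exists w, (v :: l). repeat split; auto.
      * apply IH. simpl in *; split; auto.
      * apply in_ext; auto.
Qed.

Lemma NoDup_saws n : NoDup (saws n).
Proof. apply NoDup_gen. Qed.

Lemma NoDup_flat_map_disjoint (A : Type) (f : nat -> list A) l :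
  NoDup l -> (forall n, NoDup (f n)) ->
  (forall n m a, In a (f n) -> In a (f m) -> n = m) -> NoDup (flat_map f l).
Proof.
  intros H Hf Dis. induction H as [|n l N H IH]; simpl; [constructor|].
  apply NoDup_app; auto. intros a I I'. apply in_flat_map in I' as [m [I1 I2]].
  rewrite (Dis n m a I I2) in N. auto.
Qed.

Lemma NoDup_upto N : NoDup (upto N).
Proof.
  apply NoDup_flat_map_disjoint; auto using NoDup_saws, seq_NoDup.
  intros n m g H1 H2. apply in_saws in H1 as [_ H1], H2 as [_ H2]. lia.
Qed.

Lemma in_upto N g : In g (upto N) <-> walk0 g /\ (length g <= S N)%nat.
Proof.
  unfold upto. rewrite in_flat_map. split.
  - intros [n [I H]]. apply in_seq in I. apply in_saws in H as [H L]. split; auto; lia.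
  - intros [H L]. exists (pred (length g)).
    assert (length g <> 0)%nat.
    { destruct H as [[h ->] _]. rewrite length_app. simpl; lia. }
    split; [apply in_seq; lia|]. apply in_saws. split; auto; lia.
Qed.

Definition wt (x : R) (g : list vertex) : R := x ^ pred (length g).

Definition wsum (x : R) (P : list vertex -> bool) (N : nat) : R :=
  lsum (wt x) (filter P (upto N)).

Lemma wt_nonneg x g : 0 <= x -> 0 <= wt x g.
Proof. intro. apply pow_le; auto. Qed.

Lemma wsum_nonneg x P N : 0 <= x -> 0 <= wsum x P N.
Proof. intro. apply lsum_nonneg. intros; apply wt_nonneg; auto. Qed.

Lemma wsum_le x P Q N : 0 <= x ->
  (forall g, walk0 g -> (length g <= S N)%nat -> P g = true -> Q g = true) ->
  wsum x P N <= wsum x Q N.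
Proof.
  intros Hx H. apply lsum_incl.
  - apply NoDup_filter, NoDup_upto.
  - intros g I. apply filter_In in I as [I1 I2]. apply filter_In. split; auto.
    apply in_upto in I1 as [? ?]. auto.
  - intros; apply wt_nonneg; auto.
Qed.

(** [removelast] drops the starting vertex, which is the last entry of the reversed list. *)
Definition half (g : list vertex) : bool := forallb (fun v => 1 <=? snd v)%Z (removelast g).

Definition below (T : Z) (g : list vertex) : bool := forallb (fun v => snd v <=? T)%Z g.

Definition brid (T : Z) (g : list vertex) : bool := half g && below T g && top_end T g.

Definition arc (T : Z) (g : list vertex) : bool := half g && below T g && bottom_end g.

Lemma half_app h v : half (h ++ [v]) = true <-> (forall a, In a h -> (1 <= snd a)%Z).
Proof.
  unfold half. rewrite removelast_last, forallb_forall.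
  split; intros H a I; specialize (H a I); [apply Z.leb_le|apply Z.leb_le]; auto.
Qed.

Lemma below_iff T g : below T g = true <-> (forall a, In a g -> (snd a <= T)%Z).
Proof.
  unfold below. rewrite forallb_forall.
  split; intros H a I; specialize (H a I); apply Z.leb_le; auto.
Qed.

Lemma rooted_walk0 g : rooted g -> walk0 g /\ half g = true.
Proof.
  intro R. induction R as [|w v l R [IH1 IH2] A N Y].
  - split; [|reflexivity].
    split; [exists [(0, 1)%Z]; auto|]. split; [simpl; auto 6|].
    repeat constructor; simpl; intuition discriminate.
  - split; [apply walk0_cons; auto|].
    destruct IH1 as [[h E] _]. rewrite E in *. rewrite app_comm_cons.
    apply half_app. rewrite half_app in IH2. intros a [<-|I]; auto.
Qed.

Lemma walk0_rooted w v l : walk0 (w :: v :: l) -> half (w :: v :: l) = true ->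
  rooted (w :: v :: l).
Proof.
  revert w v. induction l as [|u l IH]; intros w v W H.
  - apply walk0_cons in W as [W [A N]]. apply walk0_single in W. subst v.
    unfold half in H. simpl in H. apply andb_true_iff in H as [H%Z.leb_le _].
    pose proof (hex_adj_cases _ _ A) as C. simpl in C, H.
    replace w with (0, 1)%Z by (apply vertex_eq; simpl; lia). constructor.
  - apply walk0_cons in W as [W [A N]].
    assert (E : half (w :: v :: u :: l) = ((1 <=? snd w)%Z && half (v :: u :: l))%bool)
      by reflexivity.
    rewrite E in H. apply andb_true_iff in H as [H%Z.leb_le H'].
    constructor; auto.
Qed.

Lemma within_strip T g : rooted g -> (1 <= T)%Z ->
  (within (strip T) g <-> below T g = true).
Proof.
  intros R HT. rewrite below_iff. split; intros H a I.
  - destruct (H a I) as [->|H']; [simpl; lia|]. apply strip_true in H'; lia.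
  - destruct (rooted_row _ a R I); auto. right. apply strip_true. split; auto.
Qed.

Definition domain_walks (D : vertex -> bool) (K : nat) : list (list vertex) :=
  flat_map (gen root D) (seq 0 K).

Section Domain.
Variable D : vertex -> bool.
Hypothesis HD : forall v, D v = true -> (1 <= snd v)%Z.
Hypothesis H01 : D (0, 1)%Z = true.

Lemma in_domain_walks K g :
  In g (domain_walks D K) <-> rooted g /\ within D g /\ (length g <= S K)%nat.
Proof.
  unfold domain_walks. rewrite in_flat_map. split.
  - intros [k [I H]]. apply in_seq in I. apply in_gen_root in H as [R [W L]]; auto.
    repeat split; auto; lia.
  - intros [R [W L]].
    assert (2 <= length g)%nat by (inversion R as [|? ? ? R']; [|inversion R']; subst; simpl; lia).
    exists (length g - 2)%nat. split; [apply in_seq; lia|].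
    apply in_gen_root; auto. repeat split; auto. lia.
Qed.

Lemma NoDup_domain_walks K : NoDup (domain_walks D K).
Proof.
  apply NoDup_flat_map_disjoint; auto using NoDup_gen, seq_NoDup.
  intros n m g H1 H2. apply in_gen_root in H1 as [_ [_ H1]], H2 as [_ [_ H2]]; auto. lia.
Qed.

Lemma domain_identity K :
  lsum (fun g => wt xc g * bd D g) (domain_walks D K)
  + xc ^ K * lsum (fun g => wcos (tot g)) (gen root D K) = 1.
Proof.
  rewrite <- (level_identity D HD H01 K). f_equal.
  unfold domain_walks. rewrite lsum_flat_map. apply lsum_ext. intros k _.
  rewrite <- lsum_scal. apply lsum_ext. intros g Hg.
  apply in_gen_root in Hg as [_ [_ L]]; auto. unfold wt. rewrite L.
  replace (pred (k + 2)) with (S k) by lia. reflexivity.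
Qed.

Lemma length_gen_root_le K : (length (gen root D K) <= length (saws (S K)))%nat.
Proof.
  apply NoDup_incl_length; [apply NoDup_gen|]. intros g Hg.
  apply in_gen_root in Hg as [R [_ L]]; auto. apply in_saws.
  split; [apply rooted_walk0; auto|lia].
Qed.

End Domain.

Lemma lsum_b2r (A : Type) (f : A -> R) (P : A -> bool) l :
  lsum (fun a => f a * b2r (P a)) l = lsum f (filter P l).
Proof. induction l as [|a l IH]; simpl; auto. rewrite IH. destruct (P a); simpl; lra. Qed.

Lemma lsum_abs_le (A : Type) (f : A -> R) l :
  (forall a, Rabs (f a) <= 1) -> Rabs (lsum f l) <= INR (length l).
Proof.
  intro H. induction l as [|a l IH]; [simpl; rewrite Rabs_R0; lra|].
  change (length (a :: l)) with (S (length l)). rewrite S_INR, lsum_cons.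
  eapply Rle_trans; [apply Rabs_triang|]. specialize (H a). lra.
Qed.

Lemma strip_pos T v : strip T v = true -> (1 <= snd v)%Z.
Proof. rewrite strip_true; lia. Qed.

Lemma rect_pos T L v : rect T L v = true -> (1 <= snd v)%Z.
Proof. rewrite rect_true; lia. Qed.

(** The walk without steps satisfies [half] but is not rooted; the condition on [Q] keeps it out. *)
Lemma strip_walks_perm T K (Q : list vertex -> bool) : (1 <= T)%Z ->
  (forall v, v = (0, 0)%Z -> Q [v] = false) ->
  Permutation (filter Q (domain_walks (strip T) K))
    (filter (fun g => half g && below T g && Q g) (upto K)).
Proof.
  intros HT HQ.
  assert (S01 : strip T (0, 1)%Z = true) by (apply strip_true; simpl; lia).
  apply NoDup_Permutation.
  - apply NoDup_filter, NoDup_domain_walks; auto. intros v; apply strip_pos.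
  - apply NoDup_filter, NoDup_upto.
  - intro g. rewrite !filter_In, in_upto, !andb_true_iff, in_domain_walks; auto.
    2: intros v; apply strip_pos.
    split.
    + intros [[R [W L]] HQg]. destruct (rooted_walk0 g R). repeat split; auto; try apply H.
      apply within_strip in W; auto.
    + intros [[W L] [[H B] HQg]]. destruct g as [|w [|v l]].
      * destruct W as [[[|] ?] _]; discriminate.
      * apply walk0_single in W. rewrite HQ in HQg; auto; discriminate.
      * pose proof (walk0_rooted _ _ _ W H) as R. repeat split; auto.
        apply within_strip; auto.
Qed.

(** A strip has no sides, so its exits are those of bridges and arcs. The error bounds each walk
    still inside by 1 in cosine weight and their number by all self-avoiding walks of that
    length. *)
Lemma strip_identity T K : (1 <= T)%Z ->
  Rabs (wsum xc (brid T) K + ca * wsum xc (arc T) K - 1)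
    <= xc ^ K * INR (length (saws (S K))).
Proof.
  intro HT.
  assert (S01 : strip T (0, 1)%Z = true) by (apply strip_true; simpl; lia).
  assert (HD : forall v, strip T v = true -> (1 <= snd v)%Z) by (intros v; apply strip_pos).
  pose proof (domain_identity (strip T) HD S01 K) as E.
  assert (F : lsum (fun g => wt xc g * bd (strip T) g) (domain_walks (strip T) K) =
     wsum xc (brid T) K + ca * wsum xc (arc T) K).
  { assert (H0 : forall v, v = (0, 0)%Z -> top_end T [v] = false)
      by (intros v ->; simpl; destruct T; lia || reflexivity).
    unfold wsum. rewrite <- (lsum_perm _ _ _ _ (strip_walks_perm T K _ HT H0)).
    rewrite <- (lsum_perm _ _ _ _ (strip_walks_perm T K bottom_end HT
      (fun v _ => eq_refl))).
    rewrite <- !lsum_b2r, <- lsum_scal, <- lsum_plus. apply lsum_ext.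
    intros g Hg. apply in_domain_walks in Hg as [R [W _]]; auto.
    destruct g as [|v [|u l]]; try (inversion R; fail).
    rewrite bd_strip; auto. ring. }
  rewrite F in E.
  replace (wsum xc (brid T) K + ca * wsum xc (arc T) K - 1) with
    (- (xc ^ K * lsum (fun g => wcos (tot g)) (gen root (strip T) K))) by lra.
  rewrite Rabs_Ropp, Rabs_mult, (Rabs_pos_eq (xc ^ K)) by (apply pow_le, Rlt_le, xc_pos).
  apply Rmult_le_compat_l; [apply pow_le, Rlt_le, xc_pos|].
  eapply Rle_trans; [apply lsum_abs_le|].
  - intro g. apply Rabs_le. unfold wcos. pose proof (COS_bound (IZR (tot g) * (PI / 8))). lra.
  - apply le_INR, length_gen_root_le; auto.
Qed.

Lemma chain_dist v l a : chain (v :: l) -> In a (v :: l) ->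
  (Z.abs (fst a - fst v) <= Z.of_nat (length l) /\
   Z.abs (snd a - snd v) <= Z.of_nat (length l))%Z.
Proof.
  revert v. induction l as [|u l IH]; intros v C [<-|I]; try (simpl; lia).
  - destruct I.
  - destruct C as [A C]. specialize (IH u C I).
    pose proof (hex_adj_cases _ _ A). change (length (u :: l)) with (S (length l)).
    rewrite Nat2Z.inj_succ. lia.
Qed.

Lemma walk0_dist g a : walk0 g -> In a g ->
  (Z.abs (fst a) < Z.of_nat (length g) /\ Z.abs (snd a) < Z.of_nat (length g))%Z.
Proof.
  intros [[h E] [C _]] I.
  apply chain_rev in C. apply in_rev in I. rewrite <- length_rev.
  rewrite E, rev_app_distr in *. simpl app in *.
  pose proof (chain_dist _ _ _ C I) as H. simpl in H. simpl length. lia.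
Qed.

Lemma rect_finite T L : exists M, forall g, NoDup g -> within (rect T L) g ->
  (length g <= M)%nat.
Proof.
  set (xs := map (fun n => Z.of_nat n - L)%Z (seq 0 (S (Z.to_nat (2 * L))))).
  set (ys := map Z.of_nat (seq 0 (S (Z.to_nat T)))).
  exists (length ((0, 0)%Z :: list_prod xs ys)). intros g ND W.
  apply NoDup_incl_length; auto. intros [x y] I.
  destruct (W _ I) as [E|E]; [left; auto|right].
  apply rect_true in E. simpl in E. apply in_prod.
  - apply in_map_iff. exists (Z.to_nat (x + L)). split; [lia|]. apply in_seq. lia.
  - apply in_map_iff. exists (Z.to_nat y). split; [lia|]. apply in_seq. lia.
Qed.

Lemma brid_le_1 T K : (1 <= T)%Z -> wsum xc (brid T) K <= 1.
Proof.
  (* With [L = K + 1] the rectangle contains all bridges of at most [K] steps, and [K'] exceeds the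
     length of any self-avoiding walk in it, so that the remainder of the identity vanishes. *)
  intro HT. set (L := Z.of_nat (S K)). destruct (rect_finite T L) as [M HM].
  set (K' := (K + M)%nat).
  assert (S01 : rect T L (0, 1)%Z = true) by (apply rect_true; simpl; lia).
  assert (HD : forall v, rect T L v = true -> (1 <= snd v)%Z) by (intros v; apply rect_pos).
  pose proof (domain_identity (rect T L) HD S01 K') as E.
  rewrite (all_out_nil _ (gen root (rect T L) K')) in E.
  2:{ intros g Hg. apply in_gen_root in Hg as [R [W Len]]; auto.
      specialize (HM g (rooted_NoDup _ R) W). lia. }
  simpl lsum in E at 2. rewrite Rmult_0_r, Rplus_0_r in E. rewrite <- E.
  apply Rle_trans with (lsum (wt xc) (filter (top_end T) (domain_walks (rect T L) K'))).
  - apply lsum_incl.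
    + apply NoDup_filter, NoDup_upto.
    + intros g Hg. apply filter_In in Hg as [Hg B]. apply in_upto in Hg as [W Len].
      unfold brid in B. rewrite !andb_true_iff in B. destruct B as [[H B] Tp].
      apply filter_In. split; auto. apply in_domain_walks; auto.
      assert (R : rooted g).
      { destruct g as [|w [|v l]].
        - discriminate.
        - apply walk0_single in W. subst w. simpl in Tp. destruct T; lia || discriminate.
        - apply walk0_rooted; auto. }
      repeat split; auto; [|lia].
      intros a I. destruct (rooted_row _ a R I); auto. right. apply rect_true.
      rewrite below_iff in B. specialize (B a I). pose proof (walk0_dist g a W I). lia.
    + intros; apply wt_nonneg, Rlt_le, xc_pos.
  - rewrite <- lsum_b2r. apply lsum_le. intros g Hg.
    apply in_domain_walks in Hg as [R [W _]]; auto.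
    apply Rmult_le_compat_l; [apply wt_nonneg, Rlt_le, xc_pos|].
    destruct g as [|v [|u l]]; try (inversion R; fail). apply bd_rect; auto; lia.
Qed.

(* The automorphism of the lattice taking [s] to the origin; it exchanges up and down
   when [s] is odd. *)
Definition norm (s v : vertex) : vertex :=
  (fst v - fst s, if veven s then snd v - snd s else snd s - snd v)%Z.

Definition unnorm (s v : vertex) : vertex :=
  (fst v + fst s, if veven s then snd v + snd s else snd s - snd v)%Z.

Lemma unnorm_norm s v : unnorm s (norm s v) = v.
Proof. apply vertex_eq; unfold unnorm, norm; destruct (veven s); simpl; lia. Qed.

Lemma norm_self s : norm s s = (0, 0)%Z.
Proof. apply vertex_eq; unfold norm; destruct (veven s); simpl; lia. Qed.

Lemma norm_adj s p q : hex_adj p q -> hex_adj (norm s p) (norm s q).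
Proof.
  intro A.
  assert (P : veven (norm s p) = if veven s then veven p else negb (veven p)).
  { unfold norm, veven. destruct (Z.even (fst s + snd s)) eqn:E; cbn [fst snd];
    rewrite ?Z.negb_even.
    - replace (fst p - fst s + (snd p - snd s))%Z with ((fst p + snd p) - (fst s + snd s))%Z by lia.
      rewrite Z.even_sub, E. destruct (Z.even (fst p + snd p)); reflexivity.
    - replace (fst p - fst s + (snd s - snd p))%Z
        with ((fst p + snd p) - (fst s + snd s) + 2 * (snd s - snd p))%Z by lia.
      rewrite Z.even_add, Z.even_sub, E, Z.even_mul, <- Z.negb_even. simpl.
      destruct (Z.even (fst p + snd p)); reflexivity. }
  assert (X : forall a b : vertex,
   (snd b = snd a /\ (fst b = fst a + 1 \/ fst b = fst a - 1) \/
    fst b = fst a /\ (veven a = true /\ snd b = snd a + 1 \/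
    veven a = false /\ snd b = snd a - 1))%Z -> hex_adj a b).
  { intros [] []; unfold veven; simpl; auto. }
  apply X. rewrite P. unfold norm; cbn [fst snd]. pose proof (hex_adj_cases _ _ A).
  destruct (veven s), (veven p); simpl negb; lia.
Qed.

Lemma chain_map_norm s l : chain l -> chain (map (norm s) l).
Proof.
  induction l as [|a [|b l] IH]; auto. intros [A C]. split; [apply norm_adj; auto|].
  apply IH; auto.
Qed.

Lemma NoDup_map_norm s l : NoDup l -> NoDup (map (norm s) l).
Proof.
  apply FinFun.Injective_map_NoDup. intros a b E.
  rewrite <- (unnorm_norm s a), E. apply unnorm_norm.
Qed.

Lemma walk0_norm l s : chain (l ++ [s]) -> NoDup (l ++ [s]) ->
  walk0 (map (norm s) (l ++ [s])).
Proof.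
  intros C ND. split; [|split; auto using chain_map_norm, NoDup_map_norm].
  exists (map (norm s) l). rewrite map_app. simpl. rewrite norm_self. reflexivity.
Qed.

Lemma walk0_prefix l s m : walk0 (l ++ s :: m) -> walk0 (s :: m).
Proof.
  induction l as [|a l IH]; auto. intro H. apply IH.
  destruct l; simpl in *; apply walk0_cons in H; apply H.
Qed.

Lemma map_norm_inj s l l' : map (norm s) l = map (norm s) l' -> l = l'.
Proof.
  intro E. apply (f_equal (map (unnorm s))) in E. rewrite !map_map in E.
  rewrite !(map_ext _ (fun x => x) (unnorm_norm s)), !map_id in E. exact E.
Qed.

Lemma NoDup_app_l (A : Type) (l : list A) s m : NoDup (l ++ s :: m) -> NoDup (l ++ [s]).
Proof.
  intro H. replace (l ++ s :: m) with ((l ++ [s]) ++ m) in H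
    by (rewrite <- app_assoc; reflexivity).
  apply NoDup_app_remove_r in H. exact H.
Qed.

(** Cut the walk after [m] steps and move the second piece to the origin by [norm]. As lists are
    reversed, the first piece is [skipn n]. *)
Lemma saws_submult m n :
  INR (length (saws (m + n))) <= INR (length (saws m)) * INR (length (saws n)).
Proof.
  rewrite <- (Rmult_1_r (INR (length (saws m)))), <- (Rmult_1_r (INR (length (saws n)))).
  rewrite <- (Rmult_1_r (INR (length (saws (m + n))))), <- !(lsum_const _ 1).
  rewrite <- lsum_prod, <- (Rmult_1_l (lsum _ (list_prod _ _))).
  apply lsum_inject with (phi := fun g : list vertex =>
    (skipn n g, map (norm (hd origin (skipn n g))) (firstn n g ++ [hd origin (skipn n g)])));
    try (intros; lra).
  - apply NoDup_saws.
  - intros g g' _ _ E. injection E as E1 E2. rewrite <- E1 in E2.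
    apply map_norm_inj, app_inj_tail in E2 as [E2 _].
    rewrite <- (firstn_skipn n g), <- (firstn_skipn n g'). congruence.
  - intros g Hg. apply in_saws in Hg as [W L].
    assert (L1 : length (skipn n g) = S m) by (rewrite length_skipn; lia).
    assert (L2 : length (firstn n g) = n) by (rewrite length_firstn; lia).
    pose proof (firstn_skipn n g) as E.
    destruct (skipn n g) as [|s t]; [discriminate|]. simpl hd.
    rewrite <- E in W. apply in_prod; apply in_saws.
    + split; auto. apply (walk0_prefix (firstn n g)); auto.
    + rewrite length_map, length_app, L2. simpl. split; [|lia].
      destruct W as [_ [C ND]]. apply walk0_norm.
      * apply chain_app in C. apply C.
      * apply NoDup_app_l in ND; auto.
Qed.

Lemma in_wsum P N g :
  In g (filter P (upto N)) <-> walk0 g /\ (length g <= S N)%nat /\ P g = true.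
Proof. rewrite filter_In, in_upto. tauto. Qed.

Lemma wsum_split x P Q N :
  wsum x P N = wsum x (fun g => P g && Q g) N + wsum x (fun g => P g && negb (Q g)) N.
Proof.
  assert (F : forall (f h : list vertex -> bool) l,
    filter h (filter f l) = filter (fun g => f g && h g) l).
  { intros f h l. induction l as [|a l IH]; simpl; auto.
    destruct (f a); simpl; [destruct (h a)|]; rewrite IH; auto. }
  unfold wsum. rewrite (lsum_filter _ (wt x) Q (filter P (upto N))), !F. reflexivity.
Qed.

Lemma wsum_inject x P N (B : Type) (phi : list vertex -> B) (g : B -> R) C m :
  (forall a a', walk0 a -> walk0 a' -> P a = true -> P a' = true -> phi a = phi a' -> a = a') ->
  (forall a, walk0 a -> (length a <= S N)%nat -> P a = true ->
     In (phi a) m /\ wt x a <= C * g (phi a)) ->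
  (forall b, In b m -> 0 <= g b) -> 0 <= C -> wsum x P N <= C * lsum g m.
Proof.
  intros Inj H Pos HC. apply lsum_inject with (phi := phi); auto.
  - apply NoDup_filter, NoDup_upto.
  - intros a a' Ha Ha'. apply in_wsum in Ha as [? [? ?]], Ha' as [? [? ?]]. auto.
  - intros a Ha. apply in_wsum in Ha as [? [? ?]]. apply H; auto.
  - intros a Ha. apply in_wsum in Ha as [? [? ?]]. apply H; auto.
Qed.

(** * Hammersley-Welsh decomposition *)

Fixpoint span (p : vertex -> bool) (l : list vertex) : list vertex * list vertex :=
  match l with
  | [] => ([], [])
  | a :: t => if p a then let (x, y) := span p t in (a :: x, y) else ([], l)
  end.

Lemma span_spec p l s : In s l -> p s = false ->
  exists l1 s' l2, span p l = (l1, s' :: l2) /\ l = l1 ++ s' :: l2 /\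
    p s' = false /\ (forall a, In a l1 -> p a = true).
Proof.
  induction l as [|a l IH]; intros I Ps; [destruct I|]. simpl.
  destruct (p a) eqn:E.
  - destruct I as [->|I]; [congruence|].
    destruct (IH I Ps) as [l1 [s' [l2 [-> [E1 [E2 E3]]]]]].
    exists (a :: l1), s', l2. split; [reflexivity|]. split; [simpl; congruence|]. split; auto.
    intros b [<-|J]; auto.
  - exists [], a, l. repeat split; auto.
Qed.

(** The cut vertex, head of the earlier part, belongs to both pieces: it ends the earlier one and,
    moved to the origin, starts the later one. *)
Definition cutpair (lr : list vertex * list vertex) : list vertex * list vertex :=
  (snd lr, map (norm (hd origin (snd lr))) (fst lr ++ [hd origin (snd lr)])).

Lemma cutpair_inj a b : cutpair a = cutpair b -> a = b.
Proof.
  destruct a as [l r], b as [l' r']. unfold cutpair; cbn [fst snd]. intro E.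
  injection E as -> E. apply map_norm_inj, app_inj_tail in E as [-> _]. reflexivity.
Qed.

Lemma span_app p l : fst (span p l) ++ snd (span p l) = l.
Proof.
  induction l as [|a l IH]; auto. simpl. destruct (p a); auto.
  destruct (span p l); simpl in *. congruence.
Qed.

Lemma walk0_cut l s m : walk0 (l ++ s :: m) ->
  walk0 (s :: m) /\ walk0 (map (norm s) (l ++ [s])).
Proof.
  intro W. split; [apply (walk0_prefix l); auto|]. destruct W as [_ [C ND]].
  apply walk0_norm; [apply chain_app in C; apply C|apply NoDup_app_l in ND; auto].
Qed.

Lemma half_map_norm s l : half (map (norm s) (l ++ [s])) = true <->
  (forall a, In a l -> (1 <= snd (norm s a))%Z).
Proof.
  rewrite map_app. change (map (norm s) [s]) with [norm s s]. rewrite half_app. split; intros H a I.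
  - exact (H _ (in_map (norm s) _ _ I)).
  - apply in_map_iff in I as [b [<- I]]. auto.
Qed.

Lemma half_cons_app l s m : half (l ++ s :: m) = true ->
  half (s :: m) = true /\ (forall a, In a l -> (1 <= snd a)%Z).
Proof.
  unfold half. rewrite removelast_app by discriminate.
  rewrite forallb_app, andb_true_iff. intros [H1 H2]. split; auto.
  intros a I. rewrite forallb_forall in H1. apply Z.leb_le; auto.
Qed.

Lemma vertical_unique u v c : hex_adj u v -> hex_adj u c ->
  snd v <> snd u -> snd c <> snd u -> v = c.
Proof.
  intros A%hex_adj_cases B%hex_adj_cases N1 N2.
  apply vertex_eq; destruct (veven u); intuition (try discriminate; lia).
Qed.

Lemma veven_horizontal u v : hex_adj u v -> snd v = snd u -> veven v = negb (veven u).
Proof.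
  unfold veven. intros [[E [F|F]]|[[_ [_ F]]|[_ [_ F]]]]%hex_adj_cases H; try lia;
  rewrite E, F, Z.negb_even.
  - replace (fst u + 1 + snd u)%Z with (Z.succ (fst u + snd u)) by lia. apply Z.even_succ.
  - replace (fst u - 1 + snd u)%Z with (Z.pred (fst u + snd u)) by lia. apply Z.even_pred.
Qed.

(* Without the restriction to a non-vertical last step, the last highest vertex of a
   half-plane walk could be an odd vertex entered from below, where no bridge ends. *)
Definition lastflat (g : list vertex) : bool :=
  match g with v :: u :: _ :: _ => (snd v =? snd u)%Z | _ => true end.

(** Unlike [lastflat], this also rejects a single vertical step. The exemption there is forced,
    since a half-plane walk of one step is vertical. *)
Definition lastflat1 (g : list vertex) : bool :=
  match g with v :: u :: _ => (snd v =? snd u)%Z | _ => true end.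

Definition hclass (g : list vertex) : bool := half g && lastflat g.

Definition hclass_below (m : nat) (g : list vertex) : bool :=
  hclass g && below (Z.of_nat m) g.

(* Initial pieces of a half-plane walk, cut at its last highest vertex. When that vertex
   is odd, the piece is a bridge followed by a horizontal step, or a single step. *)
Definition wbrid (T : Z) (g : list vertex) : bool :=
  half g && below T g &&
  match g with
  | v :: t => (snd v =? T)%Z &&
    (veven v || match t with u :: _ :: _ => (snd v =? snd u)%Z | _ => true end)
  | [] => false
  end.

(** A vertex has only one vertical edge, so a vertical last step can be removed without losing
    information, at the price of a factor [x]. *)
Lemma trim_bound x P Q N : 0 <= x ->
  (forall g, walk0 g -> P g = true -> exists v u l, g = v :: u :: l /\
     snd v <> snd u /\ Q (u :: l) = true) ->
  wsum x P N <= x * wsum x Q N.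
Proof.
  intros Hx H. unfold wsum at 2. apply (wsum_inject x P N _ (@tl vertex)); auto.
  - intros a a' W W' Pa Pa' E.
    destruct (H a W Pa) as [v [u [l [-> [N1 _]]]]].
    destruct (H a' W' Pa') as [v' [u' [l' [-> [N2 _]]]]].
    simpl in E. injection E as <- <-.
    apply walk0_cons in W as [_ [A _]], W' as [_ [A' _]].
    f_equal. apply (vertical_unique u); auto.
  - intros a W L Pa. destruct (H a W Pa) as [v [u [l [-> [N1 Ql]]]]]. split.
    + apply in_wsum. apply walk0_cons in W as [W _].
      split; [exact W|]. split; [simpl in L; simpl; lia|exact Ql].
    + unfold wt. simpl. lra.
  - intros; apply wt_nonneg; auto.
Qed.

(** Two consecutive vertical steps would use the same edge. *)
Lemma lastflat_tl v u l : walk0 (v :: u :: l) -> snd v <> snd u -> lastflat1 (u :: l) = true.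
Proof.
  intros W N. destruct l as [|c l]; auto. simpl. apply Z.eqb_eq.
  apply walk0_cons in W as [W [A Nv]]. apply walk0_cons in W as [_ [B _]].
  destruct (Z.eq_dec (snd u) (snd c)) as [|F]; auto. exfalso. apply Nv.
  right; left. apply (vertical_unique u); auto using hex_adj_sym.
Qed.

Lemma lastflat1_lastflat g : lastflat1 g = true -> lastflat g = true.
Proof. destruct g as [|v [|u [|]]]; auto. Qed.

Lemma half_bound x N : 0 <= x -> wsum x half N <= (1 + x) * wsum x hclass N.
Proof.
  intro Hx. rewrite (wsum_split x half lastflat).
  rewrite Rmult_plus_distr_r, Rmult_1_l. apply Rplus_le_compat_l.
  apply trim_bound; auto. intros g W H. apply andb_true_iff in H as [H L].
  destruct g as [|v [|u [|c l]]]; try discriminate.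
  apply negb_true_iff, Z.eqb_neq in L. exists v, u, (c :: l). repeat split; auto.
  unfold hclass. apply andb_true_iff. split.
  - apply (half_cons_app [v] u (c :: l)) in H. apply H.
  - apply lastflat1_lastflat, (lastflat_tl v); auto.
Qed.

Lemma all_bound x N : 0 <= x ->
  wsum x (fun _ => true) N <= (1 + x) * wsum x lastflat1 N.
Proof.
  intro Hx. rewrite (wsum_split x (fun _ => true) lastflat1). simpl andb.
  rewrite Rmult_plus_distr_r, Rmult_1_l. apply Rplus_le_compat; [apply Rle_refl|].
  apply trim_bound; auto. intros g W L.
  destruct g as [|v [|u l]]; try discriminate.
  apply negb_true_iff, Z.eqb_neq in L. exists v, u, l. repeat split; auto.
  apply (lastflat_tl v); auto.
Qed.


Lemma wt_cut (l : list vertex) s m x : 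
  wt x (l ++ s :: m) = wt x (s :: m) * wt x (map (norm s) (l ++ [s])).
Proof.
  unfold wt. rewrite length_map, !length_app, <- pow_add. simpl. f_equal. lia.
Qed.

(** A walk reaching row [S m] is cut at its last vertex there. If the walk goes on, it leaves this
    vertex downwards; the vertex is odd, [norm] turns the picture upside down, and the remainder
    becomes a half-plane walk of height at most [m]. *)
Lemma hclass_step x m N : 0 <= x ->
  wsum x (hclass_below (S m)) N <=
  (1 + wsum x (wbrid (Z.of_nat (S m))) N) * wsum x (hclass_below m) N.
Proof.
  intro Hx. rewrite (wsum_split x _ (below (Z.of_nat m))).
  rewrite Rmult_plus_distr_r, Rmult_1_l. apply Rplus_le_compat.
  - apply wsum_le; auto. intros g _ _ H. unfold hclass_below in *.
    rewrite !andb_true_iff in *. tauto.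
  - set (T := Z.of_nat (S m)). unfold wsum at 2 3.
    rewrite <- lsum_prod, <- (Rmult_1_l (lsum _ (list_prod _ _))).
    apply (wsum_inject x _ N _ (fun g => cutpair (span (fun v => snd v <? T)%Z g))); try lra.
    + intros a a' _ _ _ _ E. apply cutpair_inj in E.
      rewrite <- (span_app (fun v => snd v <? T)%Z a), E. apply span_app.
    + intros g W L H. unfold hclass_below, hclass in H.
      rewrite !andb_true_iff, negb_true_iff in H. destruct H as [[[H F] B] NB].
      fold T in B. rewrite below_iff in B.
      assert (X : exists s, In s g /\ snd s = T).
      { destruct (existsb (fun v => snd v =? T)%Z g) eqn:E.
        - apply existsb_exists in E as [s [I E%Z.eqb_eq]]. eauto.
        - exfalso. apply not_true_iff_false in NB, E. apply NB, below_iff.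
          intros a I. specialize (B a I). enough (snd a <> T) by lia.
          intro Q. apply E, existsb_exists. exists a. split; auto. apply Z.eqb_eq; auto. }
      destruct X as [s0 [I0 Hs0]].
      destruct (span_spec (fun v => snd v <? T)%Z g s0 I0) as [l1 [s [l2 [E [Eg [Ps P1]]]]]].
      { apply Z.ltb_ge; lia. }
      rewrite E. unfold cutpair; cbn [fst snd hd]. apply Z.ltb_ge in Ps.
      assert (HT : snd s = T).
      { specialize (B s). rewrite Eg in B. specialize (B (in_elt _ _ _)). lia. }
      rewrite Eg in *. clear Eg I0 NB E.
      assert (P1' : forall a, In a l1 -> (snd a < T)%Z)
        by (intros a I; apply Z.ltb_lt, P1; auto).
      destruct (walk0_cut _ _ _ W) as [W1 W2].
      destruct (half_cons_app _ _ _ H) as [H1 H2].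
      assert (Odd : l1 <> [] -> exists l t, l1 = l ++ [t] /\ snd t <> snd s /\
                hex_adj s t /\ veven s = false).
      { intro Ne. destruct (exists_last Ne) as [l [t ->]]. exists l, t.
        assert (Ht : (snd t < T)%Z) by (apply P1', in_elt).
        rewrite <- app_assoc in W. apply walk0_prefix, walk0_cons in W as [_ [A _]].
        repeat split; auto; [lia|]. apply hex_adj_cases in A. destruct (veven s); auto; lia. }
      split; [apply in_prod; apply in_wsum|].
      * split; auto. split; [rewrite length_app in L; simpl in *; lia|].
        unfold wbrid. rewrite !andb_true_iff. repeat split; auto.
        -- apply below_iff. intros a I. apply B, in_or_app; auto.
        -- apply Z.eqb_eq; auto.
        (* An odd cut vertex was entered horizontally: by [lastflat] if the walk ends there, and
           otherwise because its only vertical edge is used to leave it. *)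
        -- destruct (veven s) eqn:Es; auto. simpl.
           destruct l2 as [|u [|u' l2]]; auto. apply Z.eqb_eq.
           destruct (Z.eq_dec (snd s) (snd u)) as [|Nu]; auto. exfalso.
           destruct l1 as [|b l1].
           ++ simpl in F. apply Z.eqb_eq in F; auto.
           ++ destruct Odd as [l [t [Et [Nt [At _]]]]]; [discriminate|].
              rewrite Et in W. destruct W as [_ [_ ND]].
              apply walk0_cons in W1 as [_ [A1 _]].
              assert (t = u) by (apply (vertical_unique s); auto using hex_adj_sym).
              subst t. rewrite <- app_assoc in ND. apply NoDup_remove_2 in ND.
              apply ND, in_or_app. right; simpl; auto.
      * split; auto. split; [rewrite length_map; rewrite length_app in *; simpl in *; lia|].
        unfold hclass_below, hclass. rewrite !andb_true_iff. repeat split.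
        -- apply half_map_norm. intros a I. destruct Odd as [_ [_ [_ [_ [_ Es]]]]].
           { intros ->. destruct I. }
           unfold norm; rewrite Es; cbn [snd]. specialize (P1' a I). lia.
        -- destruct l1 as [|a [|c l1]]; auto. simpl in F |- *.
           assert (F' : snd a = snd c) by (destruct l1; apply Z.eqb_eq; auto).
           destruct l1; simpl; apply Z.eqb_eq; destruct (veven s); lia.
        -- apply below_iff. intros a I. apply in_map_iff in I as [b [<- I]].
           apply in_app_or in I as [I|[<-|[]]]; [|rewrite norm_self; simpl; lia].
           destruct Odd as [_ [_ [_ [_ [_ Es]]]]]; [intros ->; destruct I|].
           unfold norm; rewrite Es; cbn [snd]. specialize (H2 b I). lia.
      * rewrite wt_cut. lra.
    + intros [a b] I. apply Rmult_le_pos; apply wt_nonneg; auto.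
Qed.

(** A piece with an even end is a bridge. One with an odd end is a bridge followed by a horizontal
    step, the boolean of the injection recording its direction, whence [2 * x]. The single step
    [root] occurs for [m = 0] only; [x ^ S m] keeps the bound uniform. *)
Lemma wbrid_bound x m N : 0 <= x ->
  wsum x (wbrid (Z.of_nat (S m))) N <=
  (1 + 2 * x) * wsum x (brid (Z.of_nat (S m))) N + x ^ S m.
Proof.
  intro Hx. set (T := Z.of_nat (S m)).
  rewrite (wsum_split x _ (top_end T)).
  rewrite (wsum_split x (fun g => wbrid T g && negb (top_end T g))
            (fun g => (2 <? length g)%nat)).
  assert (Bd : forall g, wbrid T g = true -> half g = true /\ below T g = true).
  { intros g H. unfold wbrid in H. rewrite !andb_true_iff in H. tauto. }
  assert (X1 : wsum x (fun g => wbrid T g && top_end T g) N <= wsum x (brid T) N).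
  { apply wsum_le; auto. intros g _ _ H. apply andb_true_iff in H as [H Tp].
    apply Bd in H as [H1 H2]. unfold brid. rewrite H1, H2, Tp. reflexivity. }
  assert (X2 : wsum x (fun g => wbrid T g && negb (top_end T g) && (2 <? length g)%nat) N
             <= x * (2 * wsum x (brid T) N)).
  { assert (E2 : 2 * wsum x (brid T) N = lsum (fun p : bool * list vertex => 1 * wt x (snd p))
       (list_prod [true; false] (filter (brid T) (upto N)))).
    { change (fun p : bool * list vertex => 1 * wt x (snd p)) with
        (fun p : bool * list vertex => (fun _ : bool => 1) (fst p) * wt x (snd p)).
      rewrite lsum_prod. unfold wsum. simpl. lra. }
    rewrite E2.
    assert (Sh : forall g, walk0 g ->
      wbrid T g && negb (top_end T g) && (2 <? length g)%nat = true ->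
      exists v u l, g = v :: u :: l /\ hex_adj u v /\ snd v = snd u /\ brid T (u :: l) = true).
    { intros g W H. rewrite !andb_true_iff, negb_true_iff in H. destruct H as [[H Tp] L].
      destruct (Bd g H) as [H1 H2].
      destruct g as [|v [|u [|c l]]]; try discriminate.
      unfold wbrid in H. rewrite !andb_true_iff in H. destruct H as [_ [Hv F]].
      simpl in Tp. rewrite Hv, andb_true_r in Tp. rewrite Tp in F. simpl in F.
      apply Z.eqb_eq in F, Hv. exists v, u, (c :: l).
      assert (A : hex_adj u v) by (apply walk0_cons in W; tauto).
      repeat split; auto. unfold brid. rewrite !andb_true_iff. repeat split.
      - apply (half_cons_app [v]) in H1; tauto.
      - rewrite below_iff in *. intros a I; apply H2; right; auto.
      - simpl. rewrite (veven_horizontal v u); auto using hex_adj_sym.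
        rewrite Tp. simpl. apply Z.eqb_eq; lia. }
    apply (wsum_inject x _ N _ (fun g => ((fst (hd origin g) <? fst (hd origin (tl g)))%Z, tl g)));
      auto.
    - intros a a' W W' H H' E.
      destruct (Sh a W H) as [v [u [l [-> [A [F _]]]]]].
      destruct (Sh a' W' H') as [v' [u' [l' [-> [A' [F' _]]]]]].
      cbn [hd tl] in E. injection E as E <- <-. f_equal.
      apply hex_adj_cases in A, A'. apply vertex_eq; [|lia].
      destruct (Z.ltb_spec (fst v) (fst u)), (Z.ltb_spec (fst v') (fst u)); try discriminate; lia.
    - intros a W L H. destruct (Sh a W H) as [v [u [l [-> [A [F B]]]]]]. cbn [hd tl]. split.
      + apply in_prod; [destruct (fst v <? fst u)%Z; simpl; auto|].
        apply in_wsum. apply walk0_cons in W as [W _].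
        split; [exact W|]. split; [simpl in L; simpl; lia|exact B].
      + unfold wt. simpl. lra.
    - intros [b g] _. simpl. rewrite Rmult_1_l. apply wt_nonneg; auto. }
  assert (X3 : wsum x (fun g => wbrid T g && negb (top_end T g) && negb (2 <? length g)%nat) N
             <= x ^ S m).
  { replace (x ^ S m) with (1 * lsum (fun _ => x ^ S m) [root]) by (simpl; lra).
    assert (Sh : forall g, walk0 g ->
      wbrid T g && negb (top_end T g) && negb (2 <? length g)%nat = true ->
      g = root /\ T = 1%Z).
    { intros g W H. rewrite !andb_true_iff, !negb_true_iff in H. destruct H as [[H Tp] L].
      destruct (Bd g H) as [H1 H2]. unfold wbrid in H. rewrite !andb_true_iff in H.
      destruct H as [_ H].
      destruct g as [|v [|u [|c l]]]; try discriminate.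
      - apply walk0_single in W. subst v. simpl in H. discriminate.
      - pose proof (walk0_rooted _ _ _ W H1) as R.
        inversion R as [|? ? ? R']; subst; [|inversion R'].
        split; auto. apply andb_true_iff in H as [H%Z.eqb_eq _]. simpl in H. auto. }
    apply (wsum_inject x _ N _ (fun g => g)); try lra.
    - auto.
    - intros a W _ H. destruct (Sh a W H) as [-> HT]. split; [left; auto|].
      assert (m = 0)%nat by lia. subst m. unfold wt; simpl; lra.
    - intros. apply pow_le; auto. }
  lra.
Qed.

Lemma pow_antitone r a b : 0 <= r <= 1 -> (a <= b)%nat -> r ^ b <= r ^ a.
Proof.
  intros Hr. induction 1 as [|b H IH]; [lra|].
  simpl. pose proof (pow_le r b ltac:(lra)). nra.
Qed.

Lemma length_ge_row g v l : walk0 g -> g = v :: l -> (Z.to_nat (snd v) <= pred (length g))%nat.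
Proof.
  intros W E. pose proof (walk0_dist g v W) as D. rewrite E in *.
  specialize (D (or_introl eq_refl)). lia.
Qed.

(** A bridge of height [S m] has at least that many steps, each of which gains a factor [x / xc]
    over its weight at [xc]; [brid_le_1] bounds the rest. *)
Lemma brid_geometric x m N : 0 < x -> x <= xc ->
  wsum x (brid (Z.of_nat (S m))) N <= (x / xc) ^ S m.
Proof.
  intros Hx Hxc. pose proof xc_pos as P.
  assert (Hr : 0 < x / xc) by (apply Rdiv_lt_0_compat; auto).
  assert (Hr1 : x / xc <= 1).
  { apply Rmult_le_reg_r with xc; auto. unfold Rdiv. rewrite Rmult_assoc, Rinv_l; lra. }
  apply Rle_trans with ((x / xc) ^ S m * wsum xc (brid (Z.of_nat (S m))) N).
  - unfold wsum. rewrite <- lsum_scal. apply lsum_le. intros g I.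
    apply in_wsum in I as [W [_ B]]. unfold wt.
    replace x with ((x / xc) * xc) at 1 by (field; lra). rewrite Rpow_mult_distr.
    apply Rmult_le_compat_r; [apply pow_le; lra|].
    destruct g as [|v l]; [discriminate|].
    unfold brid in B. rewrite !andb_true_iff in B. destruct B as [_ B]. simpl in B.
    apply andb_true_iff in B as [_ B%Z.eqb_eq].
    pose proof (length_ge_row _ v l W eq_refl) as L. rewrite B in L.
    assert (Q : (S m <= pred (length (v :: l)))%nat) by lia.
    apply pow_antitone; auto; lra.
  - rewrite <- (Rmult_1_r ((x / xc) ^ S m)) at 2. apply Rmult_le_compat_l.
    + apply pow_le; lra.
    + apply brid_le_1; lia.
Qed.

Lemma xc_le_1 : xc <= 1.
Proof.
  unfold xc. rewrite <- Rinv_1. apply Rinv_le_contravar; [lra|].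
  assert (cos (PI / 3) < cos (PI / 8)).
  { pose proof PI_RGT_0. apply cos_decreasing_1; lra. }
  rewrite cos_PI3 in H. lra.
Qed.

Lemma wsum_origin_le x P N : 0 <= x ->
  (forall g, walk0 g -> P g = true -> g = [(0, 0)%Z]) -> wsum x P N <= 1.
Proof.
  intros Hx H. replace 1 with (1 * lsum (fun _ => 1) [[(0, 0)%Z]]) by (simpl; lra).
  apply (wsum_inject x P N _ (fun g => g)); try (intros; lra); auto.
  intros a W _ Pa. rewrite (H a W Pa). split; [left; auto|]. unfold wt; simpl; lra.
Qed.

(** With r = x / xc, this bounds the product of 1 + 4 r^T over all heights T, by 1 + u <= exp u and
    the geometric series. *)
Definition hbound (x : R) : R := exp (4 * (x / xc) / (1 - x / xc)).

Lemma hclass_below_bound x m N : 0 < x < xc ->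
  wsum x (hclass_below m) N <=
  exp (4 * (x / xc) / (1 - x / xc) * (1 - (x / xc) ^ m)).
Proof.
  intros [Hx Hxc]. pose proof xc_pos as P. set (r := x / xc).
  assert (Hr : 0 < r) by (apply Rdiv_lt_0_compat; auto).
  assert (Hr1 : r < 1).
  { apply Rmult_lt_reg_r with xc; auto. unfold r, Rdiv. rewrite Rmult_assoc, Rinv_l; lra. }
  induction m as [|m IH].
  - simpl pow. rewrite Rminus_diag, Rmult_0_r, exp_0. apply wsum_origin_le; [lra|].
    intros g W H. unfold hclass_below, hclass in H. rewrite !andb_true_iff in H.
    destruct H as [[H _] B]. rewrite below_iff in B.
    destruct g as [|v [|u l]].
    + destruct W as [[[|] ?] _]; discriminate.
    + apply walk0_single in W. rewrite W. reflexivity.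
    + pose proof (walk0_rooted _ _ _ W H) as R. apply rooted_head in R.
      specialize (B v (or_introl eq_refl)). simpl in B. lia.
  - eapply Rle_trans; [apply hclass_step; lra|].
    (* The constant is (1 + 2x) + 1 <= 4, as x <= xc <= 1; the last term of [wbrid_bound] is
       absorbed by x <= r. *)
    assert (B : wsum x (wbrid (Z.of_nat (S m))) N <= 4 * r ^ S m).
    { eapply Rle_trans; [apply wbrid_bound; lra|].
      pose proof (brid_geometric x m N Hx ltac:(lra)) as G. fold r in G.
      pose proof xc_le_1 as X.
      assert (Xr : x <= r).
      { apply Rmult_le_reg_r with xc; auto. unfold r, Rdiv. rewrite Rmult_assoc, Rinv_l; nra. }
      pose proof (pow_incr x r (S m) ltac:(lra)) as Xp.
      pose proof (wsum_nonneg x (brid (Z.of_nat (S m))) N ltac:(lra)).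
      pose proof (pow_lt r (S m) Hr). nra. }
    assert (E1 : 1 + wsum x (wbrid (Z.of_nat (S m))) N <= exp (4 * r ^ S m)).
    { eapply Rle_trans; [|apply exp_ineq1_le]. lra. }
    eapply Rle_trans; [apply Rmult_le_compat; [| |exact E1|exact IH]|].
    + pose proof (wsum_nonneg x (wbrid (Z.of_nat (S m))) N ltac:(lra)). lra.
    + apply wsum_nonneg; lra.
    + rewrite <- exp_plus. apply Req_le. f_equal. simpl. field. lra.
Qed.

Lemma hclass_bound x N : 0 < x < xc -> wsum x hclass N <= hbound x.
Proof.
  intros Hx. eapply Rle_trans; [|apply Rle_trans with (1 := hclass_below_bound x N N Hx)].
  - apply wsum_le; [lra|]. intros g W L H. unfold hclass_below. rewrite H.
    apply below_iff. intros a I. pose proof (walk0_dist g a W I). lia.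
  - destruct Hx as [Hx Hxc]. pose proof xc_pos as P. unfold hbound. set (r := x / xc).
    assert (Hr : 0 < r) by (apply Rdiv_lt_0_compat; auto).
    assert (Hr1 : r < 1).
    { apply Rmult_lt_reg_r with xc; auto. unfold r, Rdiv. rewrite Rmult_assoc, Rinv_l; lra. }
    assert (H : 4 * r / (1 - r) * (1 - r ^ N) <= 4 * r / (1 - r)).
    { assert (0 < 4 * r / (1 - r)) by (apply Rdiv_lt_0_compat; lra).
      pose proof (pow_lt r N Hr). nra. }
    destruct H as [H| ->]; [|lra]. apply Rlt_le, exp_increasing; auto.
Qed.

(** * General walks cut at their lowest row *)

Definition minrow (g : list vertex) : Z :=
  fold_right (fun v m => Z.min (snd v) m) (snd (last g origin)) g.

Lemma minrow_le g v : In v g -> (minrow g <= snd v)%Z.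
Proof.
  unfold minrow. generalize (snd (last g origin)) as d. intro d.
  induction g as [|a g IH]; simpl; [tauto|]. intros [->|I]; [|specialize (IH I)]; lia.
Qed.

(** The fold starts from the row of a vertex of the walk itself, so the minimum never comes from a
    foreign default. *)
Lemma minrow_attained g : g <> [] -> exists v, In v g /\ snd v = minrow g.
Proof.
  intro Ne. unfold minrow. destruct (exists_last Ne) as [h [z E]].
  assert (I : In (last g origin) g).
  { rewrite E, last_last. apply in_or_app; simpl; auto. }
  assert (X : forall d l, exists v : vertex, (v = d \/ In v l) /\
     snd v = fold_right (fun v m => Z.min (snd v) m) (snd d) l).
  { intro d. induction l as [|a l [v [H1 H2]]]; [exists d; auto|].
    simpl. destruct (Z.min_spec (snd a) (fold_right (fun v m => Z.min (snd v) m) (snd d) l))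
      as [[_ ->]|[_ ->]].
    - exists a; auto.
    - exists v. split; auto. tauto. }
  destruct (X (last g origin) g) as [v [[->|H1] H2]].
  - exists (last g origin). split; [exact I|exact H2].
  - exists v. split; [exact H1|exact H2].
Qed.

Definition lowcut (g : list vertex) : list vertex * list vertex :=
  span (fun v => minrow g <? snd v)%Z g.

Lemma lowcut_spec g : walk0 g -> exists l1 s l2, lowcut g = (l1, s :: l2) /\
  g = l1 ++ s :: l2 /\ (forall a, In a l1 -> (snd s < snd a)%Z) /\
  (forall a, In a l2 -> (snd s <= snd a)%Z).
Proof.
  intro W. assert (Ne : g <> []) by (intros ->; destruct W as [[[|] ?] _]; discriminate).
  destruct (minrow_attained g Ne) as [s0 [I0 E0]].
  destruct (span_spec (fun v => minrow g <? snd v)%Z g s0 I0)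
    as [l1 [s [l2 [E [Eg [Ps P1]]]]]]; [apply Z.ltb_ge; lia|].
  exists l1, s, l2. apply Z.ltb_ge in Ps.
  assert (Is : In s g) by (rewrite Eg; apply in_elt).
  pose proof (minrow_le g s Is) as M.
  repeat split; auto.
  - intros a I. apply P1, Z.ltb_lt in I. lia.
  - intros a I. assert (In a g) by (rewrite Eg; apply in_or_app; right; right; auto).
    pose proof (minrow_le g a H). lia.
Qed.

Lemma lowcut_inj g g' : lowcut g = lowcut g' -> g = g'.
Proof.
  unfold lowcut. intro E.
  rewrite <- (span_app (fun v => minrow g <? snd v)%Z g), E. apply span_app.
Qed.

Definition down (v : vertex) : vertex := (fst v, snd v - 1)%Z.

(* A walk ending at an odd vertex in its lowest row, reversed and started one step lower. *)
Definition reroot (r : list vertex) : list vertex :=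
  map (norm (down (hd origin r))) (rev r ++ [down (hd origin r)]).

Lemma veven_down s : veven s = false -> veven (down s) = true.
Proof.
  unfold veven, down. cbn [fst snd]. intro Es.
  replace (fst s + (snd s - 1))%Z with (Z.pred (fst s + snd s)) by lia.
  rewrite Z.even_pred, <- Z.negb_even, Es. reflexivity.
Qed.

Lemma reroot_spec s l : chain (s :: l) -> NoDup (s :: l) -> veven s = false ->
  (forall a, In a l -> (snd s <= snd a)%Z) ->
  walk0 (reroot (s :: l)) /\ half (reroot (s :: l)) = true /\
  length (reroot (s :: l)) = S (length (s :: l)).
Proof.
  intros C ND Es H. unfold reroot. cbn [hd].
  assert (H' : forall a, In a (rev (s :: l)) -> (snd s <= snd a)%Z).
  { intros a I. apply in_rev in I as [->|I]; [lia|auto]. }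
  split; [apply walk0_norm|split].
  - simpl rev. rewrite <- app_assoc. apply (chain_app (rev l) s [down s]). split.
    + apply (chain_rev (s :: l)); auto.
    + split; [apply hex_adj_sym, hex_adj_down; auto|exact I].
  - apply NoDup_app; [apply NoDup_rev; auto|repeat constructor; auto|].
    intros a I [<-|[]]. specialize (H' _ I). simpl in H'. lia.
  - apply half_map_norm. intros a I. specialize (H' _ I).
    unfold norm. rewrite veven_down by auto. simpl. lia.
  - rewrite length_map, length_app, length_rev. simpl. lia.
Qed.

(** Both rerooted walks have the image of the common start [e] as head. Since [down s] is even,
    [norm] is a translation there, and this image gives [down s] away. *)
Lemma reroot_inj s l s' l' h h' e : s :: l = h ++ [e] -> s' :: l' = h' ++ [e] ->
  veven s = false -> veven s' = false ->
  reroot (s :: l) = reroot (s' :: l') -> s :: l = s' :: l'.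
Proof.
  intros E E' Es Es' H. unfold reroot in H. cbn [hd] in H.
  assert (D : down s = down s').
  { rewrite E, E', !rev_app_distr in H. simpl in H. injection H as H1 H2 _.
    rewrite !veven_down in H2 by auto.
    unfold down in *; cbn [fst snd] in *; apply vertex_eq; cbn [fst snd]; lia. }
  rewrite D in H. apply map_norm_inj, app_inj_tail in H as [H _].
  rewrite <- (rev_involutive (s :: l)), H. apply rev_involutive.
Qed.

Lemma half_of_above l s : veven s = true ->
  (forall a, In a l -> (snd s < snd a)%Z) -> half (map (norm s) (l ++ [s])) = true.
Proof.
  intros Es H. apply half_map_norm. intros a I. specialize (H a I).
  unfold norm. rewrite Es. simpl. lia.
Qed.

Lemma lastflat_cut l1 s l2 : lastflat1 (l1 ++ s :: l2) = true ->
  lastflat (map (norm s) (l1 ++ [s])) = true.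
Proof.
  destruct l1 as [|a [|c l1]]; auto. simpl. intros F%Z.eqb_eq.
  destruct l1; simpl; apply Z.eqb_eq; destruct (veven s); lia.
Qed.

(** Cut at the last visit [s] to the lowest row. If [s] is odd, the walk cannot go up from it and
    ends there; [reroot] makes it a half-plane walk with one more step, whence [/ x]. If [s] is even
    and the start, the whole walk is a half-plane walk. Otherwise [s] is entered horizontally from
    an odd [t]: the part up to [t] is rerooted, the part from [s] on is moved to the origin, and the
    dropped step from [t] to [s] pays for the step that [reroot] adds. Its direction gives the
    factor 2. *)
Lemma lastflat1_bound x N : 0 < x ->
  wsum x lastflat1 N <= / x * wsum x half (S N)
    + (wsum x hclass N + 2 * wsum x half N * wsum x hclass N).
Proof.
  intro Hx.
  set (A := fun g => veven (hd origin (snd (lowcut g)))).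
  set (B := fun g => (1 <? length (snd (lowcut g)))%nat).
  rewrite (wsum_split x lastflat1 (fun g => negb (A g))).
  rewrite (wsum_split x (fun g => lastflat1 g && negb (negb (A g))) (fun g => negb (B g))).
  apply Rplus_le_compat; [|apply Rplus_le_compat].
  - assert (Sh : forall g, walk0 g -> lastflat1 g && negb (A g) = true ->
      exists s l, g = s :: l /\ veven s = false /\ (forall a, In a l -> (snd s <= snd a)%Z)).
    { intros g W H. rewrite andb_true_iff, negb_true_iff in H. destruct H as [F HA].
      destruct (lowcut_spec g W) as [l1 [s [l2 [E [Eg [H1 H2]]]]]].
      unfold A in HA. rewrite E in HA. cbn [hd snd] in HA.
      destruct l1 as [|a l1]; [exists s, l2; auto|]. exfalso.
      destruct (exists_last (l := a :: l1)) as [l [t Et]]; [discriminate|].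
      rewrite Et in *. rewrite Eg, <- app_assoc in W.
      apply walk0_prefix, walk0_cons in W as [_ [Ad _]].
      specialize (H1 t (in_elt _ _ _)). apply hex_adj_cases in Ad.
      destruct (veven s); try discriminate; lia. }
    unfold wsum at 2. apply (wsum_inject x _ N _ reroot).
    + intros a a' W W' H H' E.
      destruct (Sh a W H) as [s [l [-> [Es _]]]], (Sh a' W' H') as [s' [l' [-> [Es' _]]]].
      destruct W as [[h W] _], W' as [[h' W'] _].
      apply (reroot_inj _ _ _ _ h h' _ W W'); auto.
    + intros a W L H. destruct (Sh a W H) as [s [l [-> [Es Hl]]]].
      destruct (reroot_spec s l (proj1 (proj2 W)) (proj2 (proj2 W)) Es Hl) as [R1 [R2 R3]].
      split; [apply in_wsum; repeat split; auto; try apply R1; lia|].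
      unfold wt. rewrite R3. simpl. apply Req_le. field. lra.
    + intros; apply wt_nonneg; lra.
    + apply Rlt_le, Rinv_0_lt_compat; auto.
  - apply wsum_le; [lra|]. intros g W _ H.
    rewrite !andb_true_iff, !negb_involutive, negb_true_iff in H. destruct H as [[F HA] HB].
    destruct (lowcut_spec g W) as [l1 [s [l2 [E [Eg [H1 H2]]]]]].
    unfold A in HA. unfold B in HB. rewrite E in HA, HB. cbn [hd snd] in HA, HB.
    apply Nat.ltb_ge in HB. destruct l2; [|simpl in HB; lia].
    unfold hclass. apply andb_true_iff. split; [|apply lastflat1_lastflat; auto].
    rewrite Eg in *. pose proof (walk0_prefix _ _ _ W) as Ws. apply walk0_single in Ws.
    apply half_app. intros a I. specialize (H1 a I). subst s. simpl in H1. lia.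
  - assert (Sh : forall g, walk0 g ->
      lastflat1 g && negb (negb (A g)) && negb (negb (B g)) = true ->
      exists l1 s t l3, lowcut g = (l1, s :: t :: l3) /\ g = l1 ++ s :: t :: l3 /\
        veven s = true /\ veven t = false /\ hex_adj s t /\ snd t = snd s /\
        (forall a, In a l1 -> (snd s < snd a)%Z) /\
        (forall a, In a l3 -> (snd t <= snd a)%Z)).
    { intros g W H. rewrite !andb_true_iff, !negb_involutive in H. destruct H as [[F HA] HB].
      destruct (lowcut_spec g W) as [l1 [s [l2 [E [Eg [H1 H2]]]]]].
      unfold A in HA. unfold B in HB. rewrite E in HA, HB. cbn [hd snd] in HA, HB.
      apply Nat.ltb_lt in HB. destruct l2 as [|t l3]; [simpl in HB; lia|].
      exists l1, s, t, l3. rewrite Eg in W. pose proof W as W0. apply walk0_prefix in W0.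
      apply walk0_cons in W0 as [_ [Ad _]]. apply hex_adj_sym in Ad.
      assert (Et : snd t = snd s).
      { destruct (Z.eq_dec (snd t) (snd s)) as [|Nt]; auto. exfalso.
        destruct l1 as [|a l1].
        - rewrite Eg in F. simpl in F. apply Z.eqb_eq in F. congruence.
        - destruct (exists_last (l := a :: l1)) as [l [u Eu]]; [discriminate|].
          rewrite Eu in *. rewrite <- app_assoc in W.
          destruct W as [W1 [W2 ND]].
          assert (W' : walk0 (u :: s :: t :: l3)) by (apply (walk0_prefix l); repeat split; auto).
          apply walk0_cons in W' as [_ [Ad' _]].
          specialize (H1 u (in_elt _ _ _)).
          assert (u = t) by (apply (vertical_unique s); auto; lia).
          subst u. simpl app in ND. apply NoDup_remove_2 in ND. apply ND.
          apply in_or_app; right; simpl; auto. }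
      repeat split; auto.
      - rewrite (veven_horizontal s t), HA; auto.
      - intros a I. rewrite Et. apply H2; right; auto. }
    assert (E2 : 2 * wsum x half N * wsum x hclass N =
      1 * lsum (fun p : bool * (list vertex * list vertex) =>
        (fun _ : bool => 1) (fst p) *
        (fun q : list vertex * list vertex => wt x (fst q) * wt x (snd q)) (snd p))
       (list_prod [true; false] (list_prod (filter half (upto N)) (filter hclass (upto N))))).
    { rewrite (lsum_prod _ _ (fun _ : bool => 1)
        (fun q : list vertex * list vertex => wt x (fst q) * wt x (snd q))).
      rewrite (lsum_prod _ _ (wt x) (wt x)). unfold wsum. simpl. lra. }
    rewrite E2.
    apply (wsum_inject x _ N _ (fun g => let r := snd (lowcut g) in
      ((fst (hd origin r) <? fst (hd origin (tl r)))%Z,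
       (reroot (tl r), snd (cutpair (lowcut g)))))); try lra.
    + intros a a' W W' H H' E.
      destruct (Sh a W H) as [l1 [s [t [l3 [E1 [Ea [Es [Et [Ad [Ht [_ _]]]]]]]]]]].
      destruct (Sh a' W' H') as [l1' [s' [t' [l3' [E1' [Ea' [Es' [Et' [Ad' [Ht' [_ _]]]]]]]]]]].
      apply lowcut_inj. rewrite E1, E1' in *. cbn [hd tl snd] in E.
      injection E as F1 F2 F3.
      assert (X : t :: l3 = t' :: l3').
      { rewrite Ea in W. rewrite Ea' in W'. apply walk0_prefix, walk0_cons in W as [W _].
        apply walk0_prefix, walk0_cons in W' as [W' _].
        destruct W as [[h W] _], W' as [[h' W'] _].
        apply (reroot_inj _ _ _ _ h h' _ W W'); auto. }
      injection X as <- <-.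
      assert (s = s').
      { apply hex_adj_cases in Ad, Ad'. apply vertex_eq; [|lia].
        destruct (Z.ltb_spec (fst s) (fst t)), (Z.ltb_spec (fst s') (fst t));
          try discriminate; lia. }
      subst s'. apply cutpair_inj. unfold cutpair. cbn [fst snd hd] in *. congruence.
    + intros a W L H.
      destruct (Sh a W H) as [l1 [s [t [l3 [E1 [Ea [Es [Et [Ad [Ht [H1 H3]]]]]]]]]]].
      rewrite E1. unfold cutpair. cbn [hd tl fst snd].
      assert (F : lastflat1 a = true) by (rewrite !andb_true_iff in H; tauto).
      rewrite Ea in W, F, L |- *.
      destruct (walk0_cut _ _ _ W) as [W1 W2].
      apply walk0_cons in W1 as [W1 _].
      destruct (reroot_spec t l3 (proj1 (proj2 W1)) (proj2 (proj2 W1)) Et H3) as [R1 [R2 R3]].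
      rewrite length_app in L. simpl in L.
      split; [apply in_prod; [|apply in_prod; apply in_wsum]|].
      * destruct (fst s <? fst t)%Z; simpl; auto.
      * split; [exact R1|]. split; [rewrite R3; simpl; lia|exact R2].
      * split; [exact W2|]. split; [rewrite length_map, length_app; simpl; lia|].
        unfold hclass. rewrite half_of_above, (lastflat_cut l1 s (t :: l3)); auto.
      * unfold wt. rewrite R3, length_map, !length_app. apply Req_le.
        rewrite !Rmult_1_l, <- pow_add. f_equal. simpl. lia.
    + intros [c [a b]] I. cbn [fst snd]. rewrite Rmult_1_l.
      apply Rmult_le_pos; apply wt_nonneg; lra.
Qed.

Lemma saws_wsum x n : INR (length (saws n)) * x ^ n = lsum (wt x) (saws n).
Proof.
  rewrite <- lsum_const. apply lsum_ext. intros g H. apply in_saws in H as [_ H].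
  unfold wt. rewrite H. reflexivity.
Qed.

Lemma subcritical_bound x : 0 < x < xc ->
  exists C, forall n, INR (length (saws n)) * x ^ n <= C.
Proof.
  intros Hx. set (H := hbound x).
  exists ((1 + x) * (/ x * ((1 + x) * H) + (H + 2 * ((1 + x) * H) * H))).
  intro n.
  assert (X : INR (length (saws n)) * x ^ n <= wsum x (fun _ => true) n).
  { rewrite saws_wsum. unfold wsum. apply lsum_incl.
    - apply NoDup_saws.
    - intros g I. apply in_wsum. apply in_saws in I as [I1 I2]. rewrite I2. auto.
    - intros; apply wt_nonneg; lra. }
  eapply Rle_trans; [exact X|]. eapply Rle_trans; [apply all_bound; lra|].
  apply Rmult_le_compat_l; [lra|]. eapply Rle_trans; [apply lastflat1_bound; lra|].
  assert (HH : forall N, wsum x half N <= (1 + x) * H).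
  { intro N. eapply Rle_trans; [apply half_bound; lra|].
    apply Rmult_le_compat_l; [lra|]. apply hclass_bound; auto. }
  assert (HC : forall N, wsum x hclass N <= H) by (intro; apply hclass_bound; auto).
  apply Rplus_le_compat; [|apply Rplus_le_compat; auto].
  - apply Rmult_le_compat_l; auto. apply Rlt_le, Rinv_0_lt_compat; lra.
  - apply Rmult_le_compat; auto; try (apply Rmult_le_pos; [lra|]); try (apply wsum_nonneg; lra).
    apply Rmult_le_compat_l; auto; lra.
Qed.

Lemma wsum_all x N :
  wsum x (fun _ => true) N = lsum (fun n => INR (length (saws n)) * x ^ n) (seq 0 (S N)).
Proof.
  unfold wsum, upto.
  assert (F : forall l : list (list vertex), filter (fun _ => true) l = l).
  { induction l as [|a l IH]; simpl; congruence. }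
  rewrite F, lsum_flat_map. apply lsum_ext. intros n _. symmetry. apply saws_wsum.
Qed.

Lemma veven_norm s v : veven s = true -> veven (norm s v) = veven v.
Proof.
  unfold norm. intro E. rewrite E. unfold veven in *. cbn [fst snd].
  replace (fst v - fst s + (snd v - snd s))%Z with ((fst v + snd v) - (fst s + snd s))%Z by lia.
  rewrite Z.even_sub, E. destruct (Z.even (fst v + snd v)); reflexivity.
Qed.

(** * Divergence at the critical point *)

(** A top vertex of an arc is neither its start nor its end. If it is odd, its single vertical edge
    accounts for at most one of its two neighbours on the walk; the other lies in the same row and
    is even. *)
Lemma arc_top T g : (1 <= T)%Z -> walk0 g -> arc (T + 1) g = true -> below T g = false ->
  exists s, In s g /\ veven s = true /\ snd s = (T + 1)%Z.
Proof.
  intros HT W H NB. unfold arc in H. rewrite !andb_true_iff in H. destruct H as [[H B] E].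
  rewrite below_iff in B.
  assert (X : exists u, In u g /\ snd u = (T + 1)%Z).
  { destruct (existsb (fun v => snd v =? T + 1)%Z g) eqn:F.
    - apply existsb_exists in F as [s [I F%Z.eqb_eq]]. eauto.
    - exfalso. apply not_true_iff_false in NB, F. apply NB, below_iff.
      intros a I. specialize (B a I). enough (snd a <> T + 1)%Z by lia.
      intro Q. apply F, existsb_exists. exists a. split; auto. apply Z.eqb_eq; auto. }
  destruct X as [u [I Hu]]. destruct (veven u) eqn:Eu; [exists u; auto|].
  destruct (in_split u g I) as [l1 [l2 ->]].
  destruct l2 as [|b l2].
  { apply walk0_prefix, walk0_single in W. subst u. simpl in Hu; lia. }
  destruct l1 as [|a l1].
  { simpl in E. rewrite Eu in E. simpl in E. apply andb_true_iff in E as [E%Z.eqb_eq _]. lia. }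
  destruct (exists_last (l := a :: l1)) as [l [t Et]]; [discriminate|]. rewrite Et in *.
  rewrite <- app_assoc in *. simpl app in *.
  pose proof (walk0_prefix _ _ _ W) as W1. pose proof W1 as W2.
  apply walk0_cons in W1 as [W1 [A _]]. apply walk0_cons in W1 as [_ [A' _]].
  apply hex_adj_sym in A'.
  destruct (Z.eq_dec (snd t) (snd u)) as [F|F].
  { exists t. split; [apply in_elt|]. split; [|lia].
    rewrite (veven_horizontal u t), Eu; auto. }
  destruct (Z.eq_dec (snd b) (snd u)) as [F'|F'].
  { exists b. split; [apply in_or_app; simpl; auto|]. split; [|lia].
    rewrite (veven_horizontal u b), Eu; auto. }
  exfalso. apply walk0_cons in W2 as [_ [_ N]]. apply N. right; left.
  apply (vertical_unique u); auto.
Qed.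

(* An arc reaching the top row is cut at an even vertex there; both pieces, the second
   one reversed, are bridges. *)
Lemma arc_step x T N : 0 < x -> (1 <= T)%Z ->
  wsum x (arc (T + 1)) N <=
  wsum x (arc T) N + / x * (wsum x (brid (T + 1)) N * wsum x (brid (T + 1)) N).
Proof.
  intros Hx HT. rewrite (wsum_split x _ (below T)). apply Rplus_le_compat.
  - apply wsum_le; [lra|]. intros g _ _ H. unfold arc in *. rewrite !andb_true_iff in *. tauto.
  - set (p := fun v => negb (veven v && (snd v =? T + 1)%Z)).
    assert (Sh : forall g, walk0 g -> arc (T + 1) g && negb (below T g) = true ->
      exists a l1 s l2, span p g = (a :: l1, s :: l2) /\ g = a :: l1 ++ s :: l2 /\
        veven s = true /\ snd s = (T + 1)%Z /\ veven a = false /\ snd a = 1%Z).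
    { intros g W H. rewrite andb_true_iff, negb_true_iff in H. destruct H as [H NB].
      destruct (arc_top T g HT W H NB) as [s0 [I0 [E0 F0]]].
      destruct (span_spec p g s0 I0) as [l1 [s [l2 [E [Eg [Ps _]]]]]].
      { unfold p. rewrite E0, F0, Z.eqb_refl. reflexivity. }
      unfold p in Ps. rewrite negb_false_iff, andb_true_iff, Z.eqb_eq in Ps.
      unfold arc in H. rewrite !andb_true_iff in H. destruct H as [_ H].
      destruct l1 as [|a l1].
      - exfalso. rewrite Eg in H. destruct l2; simpl in H; [discriminate|].
        rewrite (proj1 Ps) in H. discriminate.
      - exists a, l1, s, l2. repeat split; try tauto.
        + rewrite Eg in H. destruct l1; simpl in H;
          rewrite !andb_true_iff, negb_true_iff in H; tauto.
        + rewrite Eg in H. destruct l1; simpl in H;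
          rewrite !andb_true_iff, Z.eqb_eq in H; tauto. }
    unfold wsum at 2 3. rewrite <- lsum_prod.
    (* Rerooting adds the step below the end of the arc, so the two pieces together have one step
       more than the arc; this is the factor [/ x]. *)
    apply (wsum_inject x _ N _ (fun g => let (l1, r) := span p g in
      (r, reroot (l1 ++ [hd origin r])))).
    + intros g g' W W' H H' E.
      destruct (Sh g W H) as [a [l1 [s [l2 [E1 [Eg [_ [_ [Ea _]]]]]]]]].
      destruct (Sh g' W' H') as [a' [l1' [s' [l2' [E1' [Eg' [_ [_ [Ea' _]]]]]]]]].
      rewrite E1, E1' in E. cbn [hd] in E. injection E as <- <- E. simpl app in E.
      apply (reroot_inj _ _ _ _ (a :: l1) (a' :: l1') s) in E; auto.
      rewrite Eg, Eg'.
      change (a :: l1 ++ [s]) with ((a :: l1) ++ [s]) in E.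
      change (a' :: l1' ++ [s]) with ((a' :: l1') ++ [s]) in E.
      apply app_inj_tail in E as [E _]. injection E as -> ->. reflexivity.
    + intros g W L H.
      destruct (Sh g W H) as [a [l1 [s [l2 [E1 [Eg [Es [Hs [Ea Ha]]]]]]]]].
      rewrite E1. cbn [hd]. rewrite andb_true_iff in H. destruct H as [H _].
      unfold arc in H. rewrite !andb_true_iff in H. destruct H as [[H B] _].
      rewrite Eg in *. clear E1 Eg.
      change (a :: l1 ++ s :: l2) with ((a :: l1) ++ s :: l2) in *.
      destruct (half_cons_app _ _ _ H) as [H1 H2]. rewrite below_iff in B.
      destruct W as [W [C ND]].
      assert (W1 : walk0 (s :: l2)) by (apply (walk0_prefix (a :: l1)); repeat split; auto).
      destruct (reroot_spec a (l1 ++ [s])) as [R1 [R2 R3]]; auto.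
      * apply chain_app in C; apply C.
      * apply (NoDup_app_l _ (a :: l1)) in ND. exact ND.
      * intros b I. apply in_app_or in I as [I|[<-|[]]]; [|lia].
        specialize (H2 b (or_intror I)). lia.
      * simpl app in R1, R2, R3 |- *. rewrite length_app in L. simpl in L.
        assert (R4 : length (reroot (a :: l1 ++ [s])) = (length l1 + 3)%nat)
          by (rewrite R3; simpl; rewrite length_app; simpl; lia).
        clear R3.
        assert (L2 : (1 <= length l2)%nat).
        { destruct l2; [|simpl; lia]. apply walk0_single in W1. subst s. simpl in Hs; lia. }
        split; [apply in_prod; apply in_wsum|].
        -- split; [exact W1|]. split; [simpl; lia|]. unfold brid.
           rewrite H1. rewrite !andb_true_iff. repeat split.
           ++ apply below_iff. intros b I. apply B, in_or_app; auto.
           ++ simpl. rewrite Es. apply Z.eqb_eq; auto.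
        -- split; [exact R1|]. split; [lia|]. unfold brid.
           rewrite R2, !andb_true_iff. repeat split.
           ++ apply below_iff. intros b I. unfold reroot in I. cbn [hd] in I.
              apply in_map_iff in I as [b' [<- I]].
              unfold norm. rewrite veven_down by auto. cbn [snd]. unfold down; cbn [snd].
              apply in_app_or in I as [I|[<-|[]]]; [|simpl; lia].
              apply in_rev in I. simpl in I.
              assert (In b' ((a :: l1) ++ s :: l2)).
              { destruct I as [<-|I]; [left; auto|right].
                apply in_app_or in I as [I|[<-|[]]]; apply in_or_app; simpl; auto. }
              specialize (B b' H0). lia.
           ++ unfold reroot. cbn [hd]. simpl rev. rewrite rev_app_distr. simpl.
              fold (norm (down a) s).
              rewrite veven_norm, Es by (apply veven_down; auto). simpl.
              rewrite veven_down by auto. apply Z.eqb_eq. lia.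
        -- cbn [fst snd]. unfold wt. rewrite R4. cbn [length]. rewrite length_app, <- pow_add.
           simpl length. apply Req_le.
           replace (pred (S (length l2)) + pred (length l1 + 3))%nat
             with (S (length l1 + S (length l2))) by lia.
           simpl. field. lra.
    + intros [a b] _. apply Rmult_le_pos; apply wt_nonneg; lra.
    + apply Rlt_le, Rinv_0_lt_compat; auto.
Qed.

(** Bridges of different heights are different walks, the height being the row of the end point. *)
Lemma brid_sum_le x k N : 0 <= x ->
  lsum (fun t => wsum x (brid (Z.of_nat t)) N) (seq 1 k) <= wsum x (fun _ => true) N.
Proof.
  intro Hx.
  apply Rle_trans with (wsum x (fun g => snd (hd origin g) <=? Z.of_nat k)%Z N).
  - induction k as [|k IH]; [apply wsum_nonneg; auto|].
    rewrite seq_S, lsum_app.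
    rewrite (wsum_split x _ (fun g => snd (hd origin g) <=? Z.of_nat k)%Z).
    apply Rplus_le_compat.
    + eapply Rle_trans; [exact IH|]. apply wsum_le; auto. intros g _ _ H.
      rewrite H, andb_true_r. apply Z.leb_le in H. apply Z.leb_le. lia.
    + change (lsum (fun t => wsum x (brid (Z.of_nat t)) N) [(1 + k)%nat]) with
        (wsum x (brid (Z.of_nat (S k))) N + 0).
      rewrite Rplus_0_r. apply wsum_le; auto. intros g _ _ H.
      unfold brid in H. rewrite !andb_true_iff in H. destruct H as [_ H].
      destruct g as [|v g]; [discriminate|]. simpl in H. apply andb_true_iff in H as [_ H%Z.eqb_eq].
      cbn [hd]. apply andb_true_iff. split; [apply Z.leb_le; lia|].
      apply negb_true_iff, Z.leb_gt. lia.
  - apply wsum_le; auto.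
Qed.

Lemma brid_1_lower x N : 0 <= x -> (2 <= N)%nat -> x ^ 2 <= wsum x (brid 1) N.
Proof.
  intros Hx HN. replace (x ^ 2) with (lsum (wt x) [[(1, 1); (0, 1); (0, 0)]%Z])
    by (unfold wt; simpl; lra).
  apply lsum_incl.
  - repeat constructor; auto.
  - intros g [<-|[]]. apply in_wsum. split; [|split; [simpl; lia|reflexivity]].
    apply rooted_walk0. constructor; [constructor|simpl; auto| |simpl; lia].
    simpl. intuition discriminate.
  - intros; apply wt_nonneg; auto.
Qed.

(** Subtract the strip identities for [T] and [T + 1] and bound the additional arcs by [arc_step].
    The quadratic bound b' + (ca / xc) b'^2 is put in exponential form by 1 + u <= exp u, so that
    iterating it over the heights adds up exponents. *)
Lemma strip_recursion T K : (1 <= T)%Z ->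
  wsum xc (brid T) K <= wsum xc (brid (T + 1)) K * exp (ca / xc * wsum xc (brid (T + 1)) K)
    + 2 * (xc ^ K * INR (length (saws (S K)))).
Proof.
  intro HT. pose proof xc_pos as Hx. pose proof ca_pos as Hc.
  pose proof (strip_identity T K HT) as I1.
  pose proof (strip_identity (T + 1) K ltac:(lia)) as I2.
  pose proof (arc_step xc T K Hx HT) as A.
  set (e := xc ^ K * INR (length (saws (S K)))) in *.
  set (b := wsum xc (brid T) K) in *. set (b' := wsum xc (brid (T + 1)) K) in *.
  assert (Hb : 0 <= b') by (apply wsum_nonneg; lra).
  assert (J1 : b + ca * wsum xc (arc T) K - 1 <= e) by (eapply Rle_trans; [apply Rle_abs|exact I1]).
  assert (J2 : - (b' + ca * wsum xc (arc (T + 1)) K - 1) <= e).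
  { eapply Rle_trans; [apply Rle_abs|]. rewrite Rabs_Ropp. exact I2. }
  assert (E : 1 + ca / xc * b' <= exp (ca / xc * b')) by apply exp_ineq1_le.
  apply (Rmult_le_compat_l b') in E; auto.
  apply (Rmult_le_compat_l ca) in A; [|lra].
  replace (ca * (wsum xc (arc T) K + / xc * (b' * b'))) with
    (ca * wsum xc (arc T) K + b' * (ca / xc * b')) in A by (field; lra).
  lra.
Qed.

(** Iterating [strip_recursion] multiplies exponentials whose exponents sum to ca / xc times the
    weight of bridges of distinct heights. The weight of all walks bounds this sum, so one [M]
    serves every height. *)
Lemma brid_propagation k K :
  let M := exp (ca / xc * wsum xc (fun _ => true) K) in
  wsum xc (brid 1) K <= M * wsum xc (brid (Z.of_nat (S k))) K
    + 2 * (xc ^ K * INR (length (saws (S K)))) * M * INR k.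
Proof.
  intro M. pose proof xc_pos as Hx. pose proof ca_pos as Hc.
  set (c := ca / xc) in *. assert (Hcc : 0 < c) by (apply Rdiv_lt_0_compat; auto).
  set (e := 2 * (xc ^ K * INR (length (saws (S K))))).
  assert (He : 0 <= e).
  { unfold e. apply Rmult_le_pos; [lra|]. apply Rmult_le_pos; [apply pow_le; lra|apply pos_INR]. }
  set (b := fun t => wsum xc (brid (Z.of_nat t)) K).
  assert (Hb : forall t, 0 <= b t) by (intro; apply wsum_nonneg; lra).
  assert (EM : forall j, exp (c * lsum b (seq 2 j)) <= M).
  { intro j. assert (Q : lsum b (seq 2 j) <= wsum xc (fun _ => true) K).
    { eapply Rle_trans; [|apply (brid_sum_le xc (S j)); lra].
      change (seq 1 (S j)) with (1%nat :: seq 2 j). rewrite lsum_cons.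
      change (wsum xc (brid (Z.of_nat 1)) K) with (b 1%nat). fold b.
      specialize (Hb 1%nat). lra. }
    unfold M. apply (Rmult_le_compat_l c) in Q; [|lra].
    destruct Q as [Q| ->]; [|lra]. apply Rlt_le, exp_increasing; auto. }
  assert (X : wsum xc (brid 1) K <= exp (c * lsum b (seq 2 k)) * b (S k) + e * M * INR k).
  { induction k as [|k IH].
    - simpl lsum. rewrite Rmult_0_r, exp_0. change (b 1%nat) with (wsum xc (brid 1) K). simpl; lra.
    - eapply Rle_trans; [exact IH|]. rewrite S_INR, seq_S, lsum_app.
      change (lsum b [(2 + k)%nat]) with (b (S (S k)) + 0).
      rewrite Rplus_0_r, Rmult_plus_distr_l, exp_plus.
      pose proof (strip_recursion (Z.of_nat (S k)) K ltac:(lia)) as R.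
      replace (Z.of_nat (S k) + 1)%Z with (Z.of_nat (S (S k))) in R by lia.
      fold (b (S k)) in R. fold (b (S (S k))) in R. fold c in R. fold e in R.
      specialize (EM k).
      apply (Rmult_le_compat_l (exp (c * lsum b (seq 2 k)))) in R;
        [|apply Rlt_le, exp_pos].
      apply (Rmult_le_compat_r e) in EM; auto. lra. }
  eapply Rle_trans; [exact X|]. apply Rplus_le_compat_r, Rmult_le_compat_r; [apply Hb|]. apply EM.
Qed.

Definition coeff (n : nat) : R := INR (length (saws n)) * xc ^ n.

Lemma coeff_nonneg n : 0 <= coeff n.
Proof.
  pose proof xc_pos. apply Rmult_le_pos; [apply pos_INR|apply pow_le; lra].
Qed.

(** Under a uniform bound [Z0], some level has small weight, which makes the errors in the strip
    identities small. Bridges of each height then weigh at least about xc^2 / M, and enough heights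
    together exceed [Z0]. *)
Lemma critical_unbounded Z0 : ~ (forall N, wsum xc (fun _ => true) N <= Z0).
Proof.
  intro HZ. pose proof xc_pos as Hx. pose proof ca_pos as Hc.
  assert (HZ0 : 0 <= Z0).
  { eapply Rle_trans; [|apply (HZ 0%nat)]. apply wsum_nonneg; lra. }
  assert (Small : forall d, 0 < d -> exists K, (2 <= K)%nat /\ coeff (S K) <= d).
  { intros d Hd. destruct (INR_unbounded (Z0 / d)) as [n Hn].
    assert (D : (exists K, (2 <= K)%nat /\ coeff (S K) <= d) \/
                (forall k, In k (seq 3 n) -> d <= coeff k)).
    { clear Hn. induction n as [|n [IH|IH]]; auto.
      - right. intros k [].
      - destruct (Rle_dec (coeff (3 + n)) d) as [L|L].
        + left. exists (2 + n)%nat. split; [lia|exact L].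
        + right. intros k I. rewrite seq_S in I. apply in_app_or in I as [I|[<-|[]]]; auto. lra. }
    destruct D as [D|D]; auto. exfalso.
    specialize (HZ (2 + n)%nat). rewrite wsum_all in HZ.
    change (S (2 + n)) with (3 + n)%nat in HZ. rewrite seq_app, lsum_app in HZ.
    assert (Q1 : 0 <= lsum coeff (seq 0 3)) by (apply lsum_nonneg; intros; apply coeff_nonneg).
    assert (Q2 : INR n * d <= lsum coeff (seq 3 n)).
    { rewrite <- (length_seq n 3) at 1. rewrite <- lsum_const. apply lsum_le; auto. }
    change (lsum coeff (seq 0 3) + lsum coeff (seq 3 n) <= Z0) in HZ.
    apply (Rmult_gt_compat_r d) in Hn; auto.
    replace (Z0 / d * d) with Z0 in Hn by (field; lra). lra. }
  set (M := exp (ca / xc * Z0)).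
  assert (HM : 0 < M) by apply exp_pos.
  (* The number of heights [n] makes n xc^2 exceed M Z0 by more than 1, leaving room 1 for the
     accumulated errors. *)
  destruct (INR_unbounded ((M * Z0 + 1) / xc ^ 2)) as [n Hn].
  assert (Hx2 : 0 < xc ^ 2) by (apply pow_lt; auto).
  apply (Rmult_gt_compat_r (xc ^ 2)) in Hn; auto.
  replace ((M * Z0 + 1) / xc ^ 2 * xc ^ 2) with (M * Z0 + 1) in Hn by (field; lra).
  (* The errors of the [n] heights add up to [coeff (S K)] times [q - 1], hence to less than 1 once
     [coeff (S K)] is at most [/ q]. *)
  set (q := 2 / xc * M * INR n * INR n + 1).
  assert (Hq : 0 < q).
  { unfold q. assert (0 <= 2 / xc * M * INR n * INR n); [|lra].
    pose proof (pos_INR n). assert (0 < 2 / xc) by (apply Rdiv_lt_0_compat; lra).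
    repeat apply Rmult_le_pos; lra. }
  destruct (Small (/ q)) as [K [HK HS]]; [apply Rinv_0_lt_compat; auto|].
  set (e := xc ^ K * INR (length (saws (S K)))).
  assert (Ee : e = coeff (S K) / xc) by (unfold e, coeff; simpl; field; lra).
  assert (He : 0 <= e).
  { unfold e. apply Rmult_le_pos; [apply pow_le; lra|apply pos_INR]. }
  assert (P : forall k, In k (seq 0 n) ->
     xc ^ 2 <= M * wsum xc (brid (Z.of_nat (S k))) K + 2 * e * M * INR n).
  { intros k I. apply in_seq in I.
    eapply Rle_trans; [apply (brid_1_lower xc K); [lra|auto]|].
    eapply Rle_trans; [apply (brid_propagation k K)|]. fold e.
    set (M' := exp (ca / xc * wsum xc (fun _ => true) K)).
    assert (HM' : 0 < M' <= M).
    { split; [apply exp_pos|]. specialize (HZ K).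
      assert (0 < ca / xc) by (apply Rdiv_lt_0_compat; auto).
      apply (Rmult_le_compat_l (ca / xc)) in HZ; [|lra]. unfold M', M.
      destruct HZ as [HZ| ->]; [|lra]. apply Rlt_le, exp_increasing; auto. }
    apply Rplus_le_compat.
    - apply Rmult_le_compat_r; [apply wsum_nonneg; lra|lra].
    - apply Rmult_le_compat; [apply Rmult_le_pos; lra|apply pos_INR| |apply le_INR; lia].
      apply Rmult_le_compat_l; lra. }
  apply lsum_le in P.
  rewrite lsum_const, length_seq, lsum_plus, lsum_scal, lsum_const, length_seq in P.
  assert (B : lsum (fun k => wsum xc (brid (Z.of_nat (S k))) K) (seq 0 n) <= Z0).
  { eapply Rle_trans; [|apply (HZ K)]. eapply Rle_trans; [|apply (brid_sum_le xc n); lra].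
    rewrite <- seq_shift, lsum_map. lra. }
  apply (Rmult_le_compat_l M) in B; [|lra].
  assert (C : INR n * (2 * e * M * INR n) < 1).
  { rewrite Ee.
    replace (INR n * (2 * (coeff (S K) / xc) * M * INR n)) with
      (coeff (S K) * (2 / xc * M * INR n * INR n)) by (field; lra).
    replace (2 / xc * M * INR n * INR n) with (q - 1) by (unfold q; lra).
    assert (coeff (S K) * q <= 1).
    { apply (Rmult_le_compat_r q) in HS; [|lra]. rewrite Rinv_l in HS; lra. }
    destruct (coeff_nonneg (S K)) as [G|G]; [lra|]. rewrite <- G. lra. }
  lra.
Qed.

(** If [coeff m] were some q < 1, submultiplicativity would bound the terms from [m] on by q times
    the whole partial sum A. Then (1 - q) A is at most the sum of the first [m] terms, against
    [critical_unbounded]. *)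
Lemma coeff_ge_1 m : (1 <= m)%nat -> 1 <= coeff m.
Proof.
  intro Hm. destruct (Rle_dec 1 (coeff m)) as [|Hq]; auto. exfalso.
  apply Rnot_le_lt in Hq. set (q := coeff m) in *.
  pose proof xc_pos as Hx.
  apply (critical_unbounded (lsum coeff (seq 0 m) / (1 - q))). intro N.
  set (A := wsum xc (fun _ => true) N).
  assert (E : A = lsum coeff (seq 0 (S N))) by apply wsum_all.
  assert (L1 : A <= lsum coeff (seq 0 (S N + m))).
  { rewrite seq_app, lsum_app, <- E.
    pose proof (lsum_nonneg _ coeff (seq (0 + S N) m) (fun a _ => coeff_nonneg a)). lra. }
  rewrite Nat.add_comm, seq_app, lsum_app in L1. simpl (0 + m)%nat in L1.
  assert (L2 : lsum coeff (seq m (S N)) <= q * A).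
  { rewrite E, <- lsum_scal.
    replace (seq m (S N)) with (map (Nat.add m) (seq 0 (S N))).
    - rewrite lsum_map. apply lsum_le. intros n _. unfold q, coeff.
      rewrite pow_add. pose proof (saws_submult m n) as S.
      pose proof (pow_lt xc m Hx). pose proof (pow_lt xc n Hx).
      replace (INR (length (saws m)) * xc ^ m * (INR (length (saws n)) * xc ^ n)) with
        ((INR (length (saws m)) * INR (length (saws n))) * (xc ^ m * xc ^ n)) by ring.
      apply Rmult_le_compat_r; auto. apply Rmult_le_pos; lra.
    - clear. generalize (S N) as k. intro k. rewrite <- (Nat.add_0_r m) at 2.
      generalize 0%nat as s. induction k as [|k IH]; intro s; auto.
      simpl. rewrite IH. f_equal. f_equal. lia. }
  apply Rmult_le_reg_r with (1 - q); [lra|].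
  unfold Rdiv. rewrite Rmult_assoc, Rinv_l by lra. lra.
Qed.

(** * From the enumerated walks to the counting function and its limit *)

Lemma chain_nth l : chain l <->
  (forall i, (S i < length l)%nat -> hex_adj (nth i l origin) (nth (S i) l origin)).
Proof.
  induction l as [|a [|b l] IH].
  - split; [intros _ i; simpl; lia|simpl; auto].
  - split; [intros _ i; simpl; lia|simpl; auto].
  - change (chain (a :: b :: l)) with (hex_adj b a /\ chain (b :: l)). rewrite IH. split.
    + intros [A H] [|i] Hi; [apply hex_adj_sym; exact A|].
      apply (H i). simpl in *; lia.
    + intro H. split; [apply hex_adj_sym; apply (H 0%nat); simpl; lia|].
      intros i Hi. apply (H (S i)). simpl in *; lia.
Qed.

Lemma is_saw_iff n w : is_saw n w <-> In (rev w) (saws n).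
Proof.
  rewrite in_saws, length_rev. unfold is_saw, walk0. split.
  - intros [L [O [A ND]]]. repeat split; auto using NoDup_rev.
    + destruct w as [|v w]; [discriminate|]. simpl in O. subst v.
      exists (rev w). reflexivity.
    + apply chain_rev, chain_nth. intros i Hi. apply A. lia.
  - intros [[[h E] [C ND]] L]. apply (f_equal (@rev vertex)) in E.
    rewrite rev_involutive, rev_app_distr in E. simpl in E.
    apply chain_rev in C. rewrite rev_involutive in C.
    repeat split; auto.
    + rewrite E. reflexivity.
    + intros i Hi. apply (proj1 (chain_nth w) C). lia.
    + rewrite <- (rev_involutive w). apply NoDup_rev; auto.
Qed.

Lemma counts_saws_length sigma n : counts_saws sigma -> sigma n = length (saws n).
Proof.
  intro H. destruct (H n) as [L [ND [E HL]]]. rewrite <- E, <- (length_map (@rev vertex) L).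
  apply Permutation_length, NoDup_Permutation.
  - apply FinFun.Injective_map_NoDup; auto. intros a b X.
    rewrite <- (rev_involutive a), X. apply rev_involutive.
  - apply NoDup_saws.
  - intro g. rewrite in_map_iff. split.
    + intros [w [<- I]]. apply is_saw_iff, HL; auto.
    + intro I. exists (rev g). rewrite rev_involutive. split; auto.
      apply HL, is_saw_iff. rewrite rev_involutive. exact I.
Qed.

Lemma xc_inv : / xc = sqrt (2 + sqrt 2).
Proof.
  unfold xc. rewrite Rinv_inv. pose proof cos_PI8_pos as P.
  symmetry. apply sqrt_lem_1; try lra.
  - pose proof (sqrt_pos 2); lra.
  - pose proof (cos_2a_cos (PI / 8)) as E.
    replace (2 * (PI / 8)) with (PI / 4) in E by lra. rewrite cos_PI4 in E.
    assert (S : sqrt 2 * sqrt 2 = 2) by (apply sqrt_sqrt; lra).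
    assert (S0 : 0 < sqrt 2) by (apply sqrt_lt_R0; lra).
    assert (S1 : 1 / sqrt 2 = sqrt 2 / 2).
    { apply Rmult_eq_reg_r with (2 * sqrt 2); [|lra]. field_simplify; [|lra]. nra. }
    rewrite S1 in E. lra.
Qed.

Theorem theorem2p3 (sigma : nat -> nat) (Hsigma : counts_saws sigma) :
  Un_cv (fun n : nat => Rpower (INR (sigma n)) (/ INR n)) (sqrt (2 + sqrt 2)).
Proof.
  rewrite <- xc_inv. pose proof xc_pos as Hx. set (mu := / xc).
  assert (Hmu : 0 < mu) by (apply Rinv_0_lt_compat; auto).
  assert (Root : forall a n, 0 < a -> (1 <= n)%nat -> Rpower (a ^ n) (/ INR n) = a).
  { intros a n Ha Hn. rewrite <- Rpower_pow, Rpower_mult, Rinv_r, Rpower_1; auto.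
    apply not_0_INR; lia. }
  assert (Low : forall n, (1 <= n)%nat -> mu ^ n <= INR (sigma n)).
  { intros n Hn. rewrite (counts_saws_length sigma n Hsigma).
    pose proof (coeff_ge_1 n Hn) as C. unfold coeff in C.
    apply Rmult_le_reg_r with (xc ^ n); [apply pow_lt; auto|].
    rewrite <- Rpow_mult_distr. unfold mu. rewrite Rinv_l, pow1; lra. }
  intros eps Heps.
  (* Since mu < y < z, the point [/ y] is subcritical and sigma_n <= C y^n; the constant is then
     absorbed by (z / y)^n for large n. *)
  set (y := mu + eps / 2). set (z := mu + eps).
  destruct (subcritical_bound (/ y)) as [C HC].
  { split; [apply Rinv_0_lt_compat; unfold y; lra|].
    rewrite <- (Rinv_inv xc). apply Rinv_lt_contravar; fold mu; unfold y; nra. }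
  assert (Hyz : Rabs (y / z) < 1).
  { rewrite Rabs_pos_eq.
    - apply Rmult_lt_reg_r with z; [unfold z; lra|].
      unfold Rdiv. rewrite Rmult_assoc, Rinv_l; unfold y, z; lra.
    - apply Rlt_le, Rdiv_lt_0_compat; unfold y, z; lra. }
  destruct (pow_lt_1_zero (y / z) Hyz (/ (Rabs C + 1))) as [N0 HN0].
  { apply Rinv_0_lt_compat. pose proof (Rabs_pos C); lra. }
  exists (S N0). intros n Hn. assert (Hn1 : (1 <= n)%nat) by lia.
  assert (Hy : 0 < y) by (unfold y; lra). assert (Hz : 0 < z) by (unfold z; lra).
  assert (Up : INR (sigma n) < z ^ n).
  { specialize (HC n). rewrite <- (counts_saws_length sigma n Hsigma) in HC.
    specialize (HN0 n ltac:(lia)). rewrite Rabs_pos_eq in HN0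
      by (apply pow_le, Rlt_le, Rdiv_lt_0_compat; auto).
    pose proof (Rle_abs C) as HA. pose proof (Rabs_pos C) as HA'.
    apply (Rmult_lt_compat_r (Rabs C + 1)) in HN0; [|lra].
    rewrite Rinv_l in HN0 by lra.
    unfold Rdiv in HN0. rewrite Rpow_mult_distr in HN0.
    rewrite pow_inv in HC, HN0.
    pose proof (pow_lt y n Hy) as Py. pose proof (pow_lt z n Hz) as Pz.
    apply (Rmult_le_compat_r (y ^ n)) in HC; [|lra].
    rewrite Rmult_assoc, Rinv_l, Rmult_1_r in HC by lra.
    apply (Rmult_lt_compat_r (z ^ n)) in HN0; auto.
    replace (y ^ n * / z ^ n * (Rabs C + 1) * z ^ n) with (y ^ n * (Rabs C + 1)) in HN0
      by (field; lra).
    nra. }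
  pose proof (Low n Hn1) as Lo.
  assert (Hn0 : 0 < / INR n) by (apply Rinv_0_lt_compat, lt_0_INR; lia).
  assert (Pm : 0 < mu ^ n) by (apply pow_lt; auto).
  assert (B1 : mu <= Rpower (INR (sigma n)) (/ INR n)).
  { rewrite <- (Root mu n) at 1; auto. apply Rle_Rpower_l; lra. }
  assert (B2 : Rpower (INR (sigma n)) (/ INR n) < z).
  { rewrite <- (Root z n); auto. apply Rlt_Rpower_l; auto. lra. }
  unfold Rdist. rewrite Rabs_pos_eq by lra. unfold z in B2. lra.
Qed.
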